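(* Let $a,c,r>0$ with $a\le r$. Let $\mathcal{H}$ be the circular hyperboloid of one sheet $\frac{x^2}{a^2}+\frac{y^2}{a^2}-\frac{z^2}{c^2}=1$ and let $\mathcal{S}$ be a sphere of radius $r$ with center $(x_c,y_c,z_c)\in\mathbb{R}^3$. Let $\lambda_1=-a^2,\lambda_2,\lambda_3,\lambda_4$ be the roots (with multiplicity, suitably labelled) of the characteristic polynomial $f(\lambda)=\det(\lambda H+S)$. Then the following relative positions are in one-to-one correspondence with the following configurations of roots, i.e. for each type, $\mathcal{H}$ and $\mathcal{S}$ are in that relative position if and only if the roots satisfy the corresponding relations: (TIc) [tangency along a circumference] if and only if $\lambda_2=\lambda_3=-a^2$ and $0<\lambda_4$; (Td) [tangent and non-tangent contact, as specified in the context] if and only if $\lambda_2=\lambda_3<-a^2$ and $0<\lambda_4$; (Ca) [non-tangent double contact, as specified in the context] if and only if $\lambda_2<\lambda_3\le -a^2$ and $0<\lambda_4$.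
   Context: The matrices associated to $\mathcal{H}$ and $\mathcal{S}$ are $$H=\operatorname{diag}(a^{-2},a^{-2},-c^{-2},-1),\qquad S=\begin{pmatrix}1&0&0&-x_c\\0&1&0&-y_c\\0&0&1&-z_c\\-x_c&-y_c&-z_c&-r^2+x_c^2+y_c^2+z_c^2\end{pmatrix},$$ so that, with $X=(x,y,z,1)^t$, the surfaces are $X^tHX=0$ and $X^tSX=0$. The polynomial $f$ has degree 4 and always has $-a^2$ as a root. $\mathcal{H}$ and $\mathcal{S}$ are in contact if there is a real point $X$ with $X^tHX=X^tSX=0$; they are tangent at such an $X$ if moreover, for all $Y$, $Y^tHX=0$ if and only if $Y^tSX=0$ (same tangent plane at $X$). The positions Td and Ca are described using a vertical plane $\Pi$ containing the $OZ$ axis and the center of $\mathcal{S}$; $\Pi$ meets $\mathcal{H}$ in a hyperbola with two branches and $\mathcal{S}$ in a circle. Type TIc: $\mathcal{H}$ and $\mathcal{S}$ are tangent at every point of a circumference. Type Td: $\mathcal{H}$ and $\mathcal{S}$ are tangent at one point and there is additional non-tangent contact; in $\Pi$ the circle is tangent to one branch of the hyperbola and meets the other branch non-tangentially. Type Ca: $\mathcal{H}$ and $\mathcal{S}$ are in contact without being tangent at any point, and $\mathcal{S}\cap\mathcal{H}$ is a curve with two connected components; in $\Pi$ the circle meets both branches of the hyperbola. *)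

(* Defs.v *)
From HB Require Import structures.
From mathcomp Require Import all_boot all_order all_algebra.
From mathcomp Require Import all_classical all_reals all_analysis.
From mathcomp Require Import ring lra.

Set Implicit Arguments.
Unset Strict Implicit.
Unset Printing Implicit Defensive.

Import Order.TTheory GRing.Theory Num.Theory.
Import numFieldNormedType.Exports.

Local Open Scope classical_set_scope.
Local Open Scope ring_scope.

Section RelativePosition.
Context {R : realType}.

Implicit Types (a c r x y z : R) (p o n : 'cV[R]_3) (X Y : 'cV[R]_4).

Definition hyp_mx a c : 'M[R]_4 :=
  diag_mx (\row_i [:: a ^- 2; a ^- 2; - c ^- 2; -1]`_i).

Definition sph_mx r x y z : 'M[R]_4 :=
  \matrix_(i, j) (nth [::]
    [:: [:: 1;   0;   0;   - x];
        [:: 0;   1;   0;   - y];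
        [:: 0;   0;   1;   - z];
        [:: - x; - y; - z; - r ^+ 2 + x ^+ 2 + y ^+ 2 + z ^+ 2]] i)`_j.

Definition pt3 x y z : 'cV[R]_3 := \col_i [:: x; y; z]`_i.

Definition hom p : 'cV[R]_4 := \col_i [:: p 0 0; p 1 0; p 2 0; 1]`_i.

Definition form (M : 'M[R]_4) X Y : R := (Y^T *m M *m X) 0 0.

Definition quadric (M : 'M[R]_4) : set 'cV[R]_3 :=
  [set p | form M (hom p) (hom p) = 0].

Lemma quadric_hypE a c : quadric (hyp_mx a c) =
  [set p | p 0 0 ^+ 2 / a ^+ 2 + p 1 0 ^+ 2 / a ^+ 2 - p 2 0 ^+ 2 / c ^+ 2 = 1].
Proof.
have E p : form (hyp_mx a c) (hom p) (hom p) =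
  p 0 0 ^+ 2 / a ^+ 2 + p 1 0 ^+ 2 / a ^+ 2 - p 2 0 ^+ 2 / c ^+ 2 - 1.
  rewrite /form /hyp_mx mul_mx_diag mxE !big_ord_recl big_ord0 !mxE /=.
  by ring.
by apply/seteqP; split=> p; rewrite /quadric /= E; lra.
Qed.

Lemma quadric_sphE r x y z : quadric (sph_mx r x y z) =
  [set p | (p 0 0 - x) ^+ 2 + (p 1 0 - y) ^+ 2 + (p 2 0 - z) ^+ 2 = r ^+ 2].
Proof.
have E p : form (sph_mx r x y z) (hom p) (hom p) =
  (p 0 0 - x) ^+ 2 + (p 1 0 - y) ^+ 2 + (p 2 0 - z) ^+ 2 - r ^+ 2.
  rewrite /form mxE !big_ord_recl big_ord0 !mxE /= !big_ord_recl !big_ord0.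
  by rewrite !mxE /=; ring.
by apply/seteqP; split=> p; rewrite /quadric /= E; lra.
Qed.

Definition contact (H S : 'M[R]_4) : set 'cV[R]_3 := quadric H `&` quadric S.

Definition tangent (H S : 'M[R]_4) : set 'cV[R]_3 :=
  [set p | contact H S p /\
     forall Y, form H (hom p) Y = 0 <-> form S (hom p) Y = 0].

Definition dot n p : R := (n^T *m p) 0 0.

Definition circumference o n (rho : R) : set 'cV[R]_3 :=
  [set p | dot n (p - o) = 0 /\ dot (p - o) (p - o) = rho ^+ 2].

(* The vertical plane containing OZ and the direction (u, v, 0), in homogeneous
   coordinates; it is a plane only if (u, v) <> (0, 0). *)
Definition vplane (u v : R) : set 'cV[R]_4 :=
  [set Y | v * Y 0 0 = u * Y 1 0].

(* The hyperbola cut by vplane u v on the quadric H has OZ as its conjugate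
   axis, so its two branches lie on either side of OZ. The one below is on the
   side of (u, v, 0); the other one is [branch H (- u) (- v)]. *)
Definition branch (H : 'M[R]_4) (u v : R) : set 'cV[R]_3 :=
  [set p | [/\ quadric H p, vplane u v (hom p) & 0 < u * p 0 0 + v * p 1 0]].

(* Tangency, inside the plane vplane u v, of the two plane sections: same
   tangent line within that plane. *)
Definition tangent_in (u v : R) (H S : 'M[R]_4) : set 'cV[R]_3 :=
  [set p | [/\ contact H S p, vplane u v (hom p) &
     forall Y, vplane u v Y ->
       (form H (hom p) Y = 0 <-> form S (hom p) Y = 0)]].

(* One-dimensional topological manifold: each point has a relatively open
   neighbourhood that is homeomorphic to an open interval. *)
Definition is_curve (C : set 'cV[R]_3) : Prop :=
  forall p, C p -> exists (U : set 'cV[R]_3) (s t : R)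
      (g : R -> 'cV[R]_3) (k : 'cV[R]_3 -> R),
    [/\ open_nbhs p U,
        {within `]s, t[, continuous g},
        {within C `&` U, continuous k},
        g @` `]s, t[ = C `&` U &
        {in `]s, t[, cancel g k}].

Definition components (C : set 'cV[R]_3) : set (set 'cV[R]_3) :=
  [set connected_component C p | p in C].

Section Types.
Variables a c r xc yc zc : R.
Let H := hyp_mx a c.
Let S := sph_mx r xc yc zc.
Let center := pt3 xc yc zc.

Definition type_TIc : Prop :=
  exists o n (rho : R),
    [/\ n != 0, 0 < rho & circumference o n rho `<=` tangent H S].

(* "One branch" and "the other branch" are told apart by the choice of
   (u, v) up to sign. *)
Definition type_Td : Prop :=
  [/\ exists! p, tangent H S p,
      exists q, contact H S q /\ ~ tangent H S q &
      exists u v : R,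
        [/\ (u, v) != (0, 0),
            vplane u v (hom center),
            exists p, branch H u v p /\ tangent_in u v H S p,
            exists q, branch H (- u) (- v) q /\ contact H S q &
            forall q, branch H (- u) (- v) q -> contact H S q ->
              ~ tangent_in u v H S q]].

Definition type_Ca : Prop :=
  [/\ contact H S !=set0,
      forall p, ~ tangent H S p,
      is_curve (contact H S),
        (components (contact H S) #= `I_2)%card &
      exists u v : R,
        [/\ (u, v) != (0, 0),
            vplane u v (hom center),
            exists p, branch H u v p /\ contact H S p &
            exists q, branch H (- u) (- v) q /\ contact H S q]].

Definition charpol : {poly R} :=
  \det ('X *: map_mx polyC H + map_mx polyC S).

(* - a ^+ 2, l2, l3, l4 are all the complex roots of charpol, with
   multiplicity. Real l2, l3, l4 suffice: any order relation used between the
   roots forces them to be real. *)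
Definition roots_are (l2 l3 l4 : R) : Prop :=
  charpol %= \prod_(l <- [:: - a ^+ 2; l2; l3; l4]) ('X - l%:P).

End Types.

End RelativePosition.

(* Main.v *)
Require Import Defs.
From mathcomp Require Import all_boot all_order all_algebra.
From mathcomp Require Import all_classical all_reals all_analysis.
From mathcomp Require Import ring lra.

(** Write [lambda H + S] as an arrow matrix: its determinant is, up to a
    positive constant, [(lambda + a ^+ 2)] times a monic cubic polynomial, whose
    roots are therefore l2, l3 and l4 ([roots_areP]). The cubic is negative at 0,
    nonpositive at [- a ^+ 2] and negative far to the left, so a positive value
    to the left of [- a ^+ 2] yields two distinct roots at most [- a ^+ 2], and
    the product of the roots makes the third one positive ([distinct_rootsP]).

    Tangency. The two quadrics are tangent at a common point p exactly when p is
    a singular point of some quadric [l H + S] of the pencil ([tangentP]); then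
    l is a double root of the cubic and the third root is positive
    ([vertex_double_root]). Conversely a double root other than [- a ^+ 2] and
    [c ^+ 2] provides one tangency point and only one ([double_root_vertex]). If
    the quadrics are tangent along a circle, all the points of the circle share
    the same l, and l must be [- a ^+ 2] because for any other value the
    horizontal coordinates of the tangency point are determined by l. Then the
    center of the sphere lies on OZ and everything is rotationally symmetric.

    Contact in the vertical plane of the center. If p is a contact point and the
    horizontal part of the center is k times that of p, the cubic at
    [a ^+ 2 * (k - 1)] is - k times a square, and this square is zero only if p
    is a tangency point ([cubic_meridian], [meridian_vertex]). On the branch
    opposite to the center, k is negative: contact with that branch forces a
    nonnegative value of the cubic to the left of [- a ^+ 2], a positive one when
    the contact is not a tangency. This excludes tangency on the near branch in
    type Td, where the double root would be larger than [- a ^+ 2], and gives the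
    roots in type Ca.

    Shape of the contact set in type Ca. If the cubic is positive at some t below
    [- a ^+ 2], the quadric [t H + S] is a two-sheeted hyperboloid of revolution
    with vertical axis ([excess_sheets]), so the contact set lies on its two
    sheets. In each vertical half-plane bounded by OZ, both a sheet and the
    hyperboloid H are graphs, the former over the distance to OZ and the latter
    over z, and the product of their Lipschitz constants is less than 1: they
    meet exactly once ([excess_mono], [height_uniq]). Each sheet thus
    contributes one closed curve, continuously parametrised by the angle around
    OZ ([sheet_curve]), and these two curves are the components. *)

Set Implicit Arguments.
Unset Strict Implicit.
Unset Printing Implicit Defensive.

Import Order.TTheory GRing.Theory Num.Theory.
Import numFieldNormedType.Exports Defs.

Local Open Scope classical_set_scope.
Local Open Scope ring_scope.

(** * Auxiliary facts on real numbers, coordinates and determinants *)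

Lemma collinear_scale (F : fieldType) (u v x y : F) :
  (u, v) != (0, 0) -> v * x = u * y -> exists k, x = k * u /\ y = k * v.
Proof.
rewrite xpair_eqE negb_and => /orP[un0|vn0] E.
  exists (x / u); rewrite divfK //; split=> //.
  by apply: (mulfI un0); rewrite -E; field.
exists (y / v); rewrite divfK //; split=> //.
by apply: (mulfI vn0); rewrite E; field.
Qed.

Lemma sqr_sum_gt0 (F : realFieldType) (u v : F) :
  (u, v) != (0, 0) -> 0 < u ^+ 2 + v ^+ 2.
Proof.
rewrite xpair_eqE negb_and => /orP[?|?].
  by rewrite ltr_pwDl ?sqr_ge0 // exprn_even_gt0.
by rewrite ltr_wpDl ?sqr_ge0 // exprn_even_gt0.
Qed.

Lemma double_root_uniq (F : realFieldType) (l m l' m' : F) :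
  (forall t, (t - l) * (t - l) * (t - m) = (t - l') * (t - l') * (t - m')) ->
  l = l'.
Proof.
move=> E; apply/eqP; rewrite -subr_eq0; apply/negPn/negP => ll'.
have := E l; rewrite subrr !mul0r => /esym/eqP.
rewrite !mulf_eq0 (negPf ll') /= subr_eq0 => /eqP lm'.
have := E l'; rewrite subrr !mul0r => /eqP.
rewrite -opprB !mulf_eq0 !oppr_eq0 (negPf ll') /= subr_eq0 => /eqP lm.
have := E (2 * l - l'); rewrite -lm' -lm => EE.
suff : (l - l') ^+ 3 == 0 by rewrite expf_eq0 (negPf ll').
by apply/eqP; lra.
Qed.

(** The first hypothesis says that the third difference of q vanishes, as it does
    for every quadratic function; it allows one to divide by [t - l] at [t = l]
    without going through formal polynomials. *)
Lemma double_root_cofactor (F : realFieldType) (q : F -> F) (l m : F) :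
  q l = 3 * q (l + 1) - 3 * q (l + 2) + q (l + 3) ->
  (forall t, (t - l) * q t = (t - l) * ((t - l) * (t - m))) -> q l = 0.
Proof.
move=> -> qE.
have -> : q (l + 1) = l + 1 - m by have := qE (l + 1); lra.
have -> : q (l + 2) = 2 * (l + 2 - m) by have := qE (l + 2); lra.
have -> : q (l + 3) = 3 * (l + 3 - m) by have := qE (l + 3); lra.
by ring.
Qed.

Lemma unit_circle_angle (R : realType) (u v : R) : u ^+ 2 + v ^+ 2 = 1 ->
  exists x, u = cos x /\ v = sin x.
Proof.
move=> uv1.
have u1 : -1 <= u <= 1.
  rewrite -ler_norml -(ler_pXn2r (n := 2)) ?nnegrE // expr1n real_normK ?num_real //.
  by have := sqr_ge0 v; lra.
have vE : sin (acos u) = `|v|.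
  rewrite sin_acos // -sqrtr_sqr; congr Num.sqrt; lra.
have [v0|v0] := leP 0 v.
  by exists (acos u); rewrite acosK ?in_itv // vE ger0_norm.
by exists (- acos u); rewrite cosN sinN acosK ?in_itv // vE ltr0_norm ?opprK.
Qed.

Lemma atan_tan_angle (R : realType) (y : R) : 0 < cos y ->
  cos (atan (sin y / cos y)) = cos y /\ sin (atan (sin y / cos y)) = sin y.
Proof.
move=> cy0; set t := sin y / cos y.
have cE : cos (atan t) = cos y.
  rewrite cos_atan (_ : 1 + t ^+ 2 = (cos y)^-1 ^+ 2).
    by rewrite sqrtr_sqr ger0_norm ?invrK // invr_ge0 ltW.
  have cn0 := lt0r_neq0 cy0.
  have -> : 1 + t ^+ 2 = (cos y ^+ 2 + sin y ^+ 2) / cos y ^+ 2 by rewrite /t; field.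
  by rewrite cos2Dsin2 div1r exprVn.
split=> //.
have : tan (atan t) = t by rewrite atanK.
rewrite /tan cE => /(congr1 ( *%R^~ (cos y))).
by rewrite /t !divfK // gt_eqF.
Qed.

Lemma continuous_pt3 (R : realType) (T : topologicalType) (f g k : T -> R) :
  continuous f -> continuous g -> continuous k ->
  continuous (fun x => pt3 (f x) (g x) (k x)).
Proof.
move=> cf cg ck.
have -> : (fun x => pt3 (f x) (g x) (k x)) =
    (fun x => f x *: pt3 1 0 0 + g x *: pt3 0 1 0 + k x *: pt3 0 0 1).
  apply/funext => x; apply/colP => i; rewrite !mxE.
  by case: i => [[|[|[|//]]] ?] /=; rewrite ?mulr1 ?mulr0 ?addr0 ?add0r.
move=> x; apply: cvgD; first apply: cvgD; apply: cvgZr_tmp.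
- exact: cf.
- exact: cg.
- exact: ck.
Qed.

Lemma cV3P (F : Type) (p q : 'cV[F]_3) :
  p 0 0 = q 0 0 -> p 1 0 = q 1 0 -> p 2 0 = q 2 0 -> p = q.
Proof.
move=> e0 e1 e2; apply/colP => -[[|[|[|//]]] i3].
- by rewrite (_ : Ordinal i3 = 0) //; apply: val_inj.
- by rewrite (_ : Ordinal i3 = 1) //; apply: val_inj.
- by rewrite (_ : Ordinal i3 = 2) //; apply: val_inj.
Qed.

Lemma dotE (R : realType) (p q : 'cV[R]_3) :
  dot p q = p 0 0 * q 0 0 + p 1 0 * q 1 0 + p 2 0 * q 2 0.
Proof.
rewrite /dot mxE !big_ord_recl big_ord0 !mxE addr0 addrA.
by congr (_ + _ * _ + _ * _); congr (_ _ 0); apply: val_inj.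
Qed.

Lemma det_arrow (R : comNzRingType) (A B D x y z : R) :
  \det (\matrix_(i < 4, j < 4) (nth [::]
    [:: [:: A; 0; 0; x]; [:: 0; A; 0; y]; [:: 0; 0; B; z];
        [:: x; y; z; D]] i)`_j) =
  A * (A * B * D - (x ^+ 2 + y ^+ 2) * B - z ^+ 2 * A).
Proof.
rewrite (expand_det_row _ ord0) !big_ord_recl big_ord0 /cofactor !mxE /=.
rewrite !(mul0r, add0r, addr0).
rewrite !(expand_det_row (row' ord0 _) ord0) !big_ord_recl !big_ord0 /cofactor.
rewrite !mxE /= !(mul0r, add0r, addr0).
rewrite !(expand_det_row (row' ord0 (col' _ (row' ord0 _))) ord0).
rewrite !big_ord_recl !big_ord0 /cofactor !det_mx11 !mxE /=.
by ring.
Qed.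

(** * The characteristic polynomial and the tangency condition *)

Section Position.
Context {R : realType}.
Variables a c r xc yc h : R.
Hypotheses (a_gt0 : 0 < a) (c_gt0 : 0 < c) (r_gt0 : 0 < r).

Let H := hyp_mx a c.
Let S := sph_mx r xc yc h.

Implicit Types (p q : 'cV[R]_3) (Y : 'cV[R]_4) (l t u v z : R).

Let a2_gt0 : 0 < a ^+ 2. Proof. exact: exprn_gt0. Qed.
Let c2_gt0 : 0 < c ^+ 2. Proof. exact: exprn_gt0. Qed.
Let r2_gt0 : 0 < r ^+ 2. Proof. exact: exprn_gt0. Qed.
Let a2_neq0 : a ^+ 2 != 0. Proof. exact: lt0r_neq0. Qed.
Let c2_neq0 : c ^+ 2 != 0. Proof. exact: lt0r_neq0. Qed.

(** This is the determinant of [t H + S], multiplied by [a ^+ 4 * c ^+ 2] and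
    divided by its factor [a ^+ 2 + t]. *)
Definition cubic t : R :=
  (a ^+ 2 + t) * (c ^+ 2 - t) * (xc ^+ 2 + yc ^+ 2 + h ^+ 2 - r ^+ 2 - t)
  - (xc ^+ 2 + yc ^+ 2) * a ^+ 2 * (c ^+ 2 - t) - h ^+ 2 * c ^+ 2 * (a ^+ 2 + t).

(** The same cubic as a formal polynomial, for comparison with [charpol] and for
    the intermediate value theorem. *)
Definition cubic_poly : {poly R} :=
  ((a ^+ 2)%:P + 'X) * ((c ^+ 2)%:P - 'X) *
     ((xc ^+ 2 + yc ^+ 2 + h ^+ 2 - r ^+ 2)%:P - 'X)
   - ((xc ^+ 2 + yc ^+ 2) * a ^+ 2)%:P * ((c ^+ 2)%:P - 'X)
   - (h ^+ 2 * c ^+ 2)%:P * ((a ^+ 2)%:P + 'X).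

Lemma horner_cubic t : cubic_poly.[t] = cubic t.
Proof. by rewrite /cubic_poly /cubic !hornerE. Qed.

Lemma charpolE : charpol a c r xc yc h =
  (a ^- 2 * a ^- 2 * c ^- 2)%:P * ('X + (a ^+ 2)%:P) * cubic_poly.
Proof.
rewrite /charpol.
set A := 'X * (a ^- 2)%:P + 1; set B := 1 - 'X * (c ^- 2)%:P.
set D := (- r ^+ 2 + xc ^+ 2 + yc ^+ 2 + h ^+ 2)%:P - 'X.
rewrite [X in \det X](_ : _ = \matrix_(i < 4, j < 4) (nth [::]
    [:: [:: A; 0; 0; (- xc)%:P]; [:: 0; A; 0; (- yc)%:P];
        [:: 0; 0; B; (- h)%:P]; [:: (- xc)%:P; (- yc)%:P; (- h)%:P; D]] i)`_j).
  rewrite det_arrow /cubic_poly /A /B /D.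
  have ha : (a ^- 2)%:P * (a ^+ 2)%:P = 1 :> {poly R} by rewrite -polyCM mulVf.
  have hc : (c ^- 2)%:P * (c ^+ 2)%:P = 1 :> {poly R} by rewrite -polyCM mulVf.
  by ring: ha hc.
apply/matrixP => i j; rewrite !mxE /=.
case: i => [[|[|[|[|//]]]] ?]; case: j => [[|[|[|[|//]]]] ?] //=;
  rewrite /A /B /D ?(mulr0n, mulr1n, polyCN, polyC0, polyC1); by ring.
Qed.

(** Both sides are monic cubics, so that being associate, being equal and
    taking the same values all coincide. *)
Lemma roots_areP l2 l3 l4 : roots_are a c r xc yc h l2 l3 l4 <->
  forall t, cubic t = (t - l2) * (t - l3) * (t - l4).
Proof.
set P : {poly R} := ('X - l2%:P) * ('X - l3%:P) * ('X - l4%:P).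
have kn0 : a ^- 2 * a ^- 2 * c ^- 2 != 0 by rewrite !mulf_neq0 ?invr_eq0.
have Xn0 : 'X + (a ^+ 2)%:P != 0 :> {poly R}.
  by rewrite -size_poly_eq0 size_XaddC.
have PE : \prod_(l <- [:: - a ^+ 2; l2; l3; l4]) ('X - l%:P) =
    ('X + (a ^+ 2)%:P) * P :> {poly R}.
  by rewrite !big_cons big_nil polyCN opprK mulr1 /P !mulrA.
rewrite /roots_are charpolE PE -mulrA mul_polyC.
rewrite (eqp_ltrans (eqp_scale _ kn0)) eqp_mul2l //.
split=> [/eqpP[[k1 k2] /= /andP[k1n0 k2n0] /(congr1 horner) E]|E].
  have {}E t : k1 * cubic t = k2 * ((t - l2) * (t - l3) * (t - l4)).
    by have := congr1 (@^~ t) E; rewrite !hornerZ horner_cubic /P !hornerE.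
  suff k12 : k1 = k2 by move=> t; apply: (mulfI k1n0); rewrite E k12.
  (* Both cubics are monic, so their third differences are 6. *)
  have := E 0; have := E 1; have := E 2; have := E 3; rewrite /cubic; lra.
suff -> : cubic_poly = P by rewrite eqpxx.
apply/eqP; rewrite -subr_eq0; apply/eqP.
have E0 := E 0; have E1 := E 1; have E2 := E (-1).
pose d2 := a ^+ 2 - c ^+ 2 - (xc ^+ 2 + yc ^+ 2 + h ^+ 2 - r ^+ 2) + (l2 + l3 + l4).
pose d1 := (c ^+ 2 - a ^+ 2) * (xc ^+ 2 + yc ^+ 2 + h ^+ 2 - r ^+ 2)
  - a ^+ 2 * c ^+ 2 + (xc ^+ 2 + yc ^+ 2) * a ^+ 2 - h ^+ 2 * c ^+ 2
  - (l2 * l3 + l2 * l4 + l3 * l4).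
pose d0 := cubic 0 + l2 * l3 * l4.
have -> : cubic_poly - P = d2%:P * 'X ^+ 2 + d1%:P * 'X + d0%:P.
  rewrite /cubic_poly /P /d2 /d1 /d0 /cubic; ring.
have -> : d2 = 0 by move: E0 E1 E2; rewrite /d2 /cubic; lra.
have -> : d1 = 0 by move: E0 E1 E2; rewrite /d1 /cubic; lra.
have -> : d0 = 0 by move: E0; rewrite /d0; lra.
by rewrite !polyC0 !mul0r !addr0.
Qed.

Lemma contactP p : contact H S p <->
  c ^+ 2 * (p 0 0 ^+ 2 + p 1 0 ^+ 2) = a ^+ 2 * (c ^+ 2 + p 2 0 ^+ 2) /\
  (p 0 0 - xc) ^+ 2 + (p 1 0 - yc) ^+ 2 + (p 2 0 - h) ^+ 2 = r ^+ 2.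
Proof.
rewrite /contact /H /S quadric_hypE quadric_sphE /= /setI /=.
have E : p 0 0 ^+ 2 / a ^+ 2 + p 1 0 ^+ 2 / a ^+ 2 - p 2 0 ^+ 2 / c ^+ 2 - 1 =
  (c ^+ 2 * (p 0 0 ^+ 2 + p 1 0 ^+ 2) - a ^+ 2 * (c ^+ 2 + p 2 0 ^+ 2))
    / (a ^+ 2 * c ^+ 2) by field; rewrite !gt_eqF.
split=> -[hp sp]; split=> //; apply/eqP; rewrite -subr_eq0.
  have : (c ^+ 2 * (p 0 0 ^+ 2 + p 1 0 ^+ 2) - a ^+ 2 * (c ^+ 2 + p 2 0 ^+ 2))
    / (a ^+ 2 * c ^+ 2) == 0 by rewrite -E hp subrr.
  by rewrite mulf_eq0 invr_eq0 mulf_eq0 (negPf a2_neq0) (negPf c2_neq0) !orbF.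
by rewrite E hp subrr mul0r.
Qed.

(** The hyperboloid meets the plane of height z in a circle of this radius. *)
Definition radius z : R := a / c * Num.sqrt (c ^+ 2 + z ^+ 2).

Lemma radius_gt0 z : 0 < radius z.
Proof. by rewrite mulr_gt0 ?divr_gt0 // sqrtr_gt0 ltr_wpDr ?sqr_ge0. Qed.

Lemma sqr_radius z : c ^+ 2 * radius z ^+ 2 = a ^+ 2 * (c ^+ 2 + z ^+ 2).
Proof.
have cz0 : 0 < c ^+ 2 + z ^+ 2 by rewrite ltr_wpDr ?sqr_ge0.
rewrite /radius exprMn sqr_sqrtr ?(ltW cz0) //.
by field; rewrite gt_eqF.
Qed.

Lemma contact_radius p : contact H S p ->
  p 0 0 ^+ 2 + p 1 0 ^+ 2 = radius (p 2 0) ^+ 2.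
Proof. by move=> /contactP[hp _]; apply: (mulfI c2_neq0); rewrite hp sqr_radius. Qed.

Lemma sqr_radiusE z : radius z ^+ 2 = a ^+ 2 * (c ^+ 2 + z ^+ 2) / c ^+ 2.
Proof. by rewrite -sqr_radius mulrAC divff ?mul1r. Qed.

Lemma contact_off_axis p : contact H S p -> 0 < p 0 0 ^+ 2 + p 1 0 ^+ 2.
Proof. by move=> /contact_radius ->; rewrite exprn_gt0 // radius_gt0. Qed.

Let ord4E : ((ord0 = 0 :> 'I_4) * (lift ord0 ord0 = 1 :> 'I_4) *
  (lift ord0 (lift ord0 ord0) = 2 :> 'I_4) *
  (lift ord0 (lift ord0 (lift ord0 ord0)) = 3 :> 'I_4))%type.
Proof. by do 3?split; apply: val_inj. Qed.

Lemma form_hypE p Y : form H (hom p) Y =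
  p 0 0 / a ^+ 2 * Y 0 0 + p 1 0 / a ^+ 2 * Y 1 0 - p 2 0 / c ^+ 2 * Y 2 0 - Y 3 0.
Proof.
rewrite /form /H /hyp_mx mul_mx_diag mxE !big_ord_recl big_ord0 !mxE /=.
rewrite !ord4E.
by ring.
Qed.

Lemma form_sphE p Y : form S (hom p) Y =
  (p 0 0 - xc) * Y 0 0 + (p 1 0 - yc) * Y 1 0 + (p 2 0 - h) * Y 2 0
  + (xc ^+ 2 + yc ^+ 2 + h ^+ 2 - r ^+ 2 - xc * p 0 0 - yc * p 1 0 - h * p 2 0)
    * Y 3 0.
Proof.
rewrite /form /S mxE !big_ord_recl big_ord0 !mxE /= !big_ord_recl !big_ord0.
rewrite !mxE /=.
rewrite !ord4E.
by ring.
Qed.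

(** The equations [(l H + S) (hom p) = 0], cleared of denominators: p is a
    singular point of the quadric [l H + S]. *)
Definition pencil_vertex l p : Prop :=
  [/\ (a ^+ 2 + l) * p 0 0 = a ^+ 2 * xc, (a ^+ 2 + l) * p 1 0 = a ^+ 2 * yc,
      (c ^+ 2 - l) * p 2 0 = c ^+ 2 * h &
      xc * p 0 0 + yc * p 1 0 + h * p 2 0 =
        xc ^+ 2 + yc ^+ 2 + h ^+ 2 - r ^+ 2 - l].

Lemma pencil_vertex_center l p : pencil_vertex l p ->
  [/\ xc = (a ^+ 2 + l) * p 0 0 / a ^+ 2, yc = (a ^+ 2 + l) * p 1 0 / a ^+ 2 &
      h = (c ^+ 2 - l) * p 2 0 / c ^+ 2].
Proof. by case=> -> -> -> _; split; rewrite mulrAC divff ?mul1r. Qed.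

Lemma pencil_vertexP l p : pencil_vertex l p <->
  forall Y, form S (hom p) Y = - l * form H (hom p) Y.
Proof.
split=> [vp Y|E].
  have [xcE ycE hE] := pencil_vertex_center vp; have [_ _ _ k1] := vp.
  rewrite form_hypE form_sphE.
  have -> : xc ^+ 2 + yc ^+ 2 + h ^+ 2 - r ^+ 2
    - xc * p 0 0 - yc * p 1 0 - h * p 2 0 = l by lra.
  rewrite xcE ycE hE.
  by field; rewrite !gt_eqF.
pose e x y z w : 'cV[R]_4 := \col_i [:: x; y; z; w]`_i.
have := E (e 1 0 0 0); have := E (e 0 1 0 0); have := E (e 0 0 1 0).
have := E (e 0 0 0 1); rewrite !form_hypE !form_sphE !mxE /=.
rewrite !(mulr1, mulr0, addr0, add0r, subr0, sub0r) => k1 kz ky kx.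
split; last by lra.
- by rewrite -[xc](subKr (p 0 0)) kx; field; rewrite gt_eqF.
- by rewrite -[yc](subKr (p 1 0)) ky; field; rewrite gt_eqF.
- by rewrite -[h](subKr (p 2 0)) kz; field; rewrite gt_eqF.
Qed.

(** Two linear forms with the same kernel are proportional. The factor can be read
    off from the last coordinate, since that of [H (hom p)] is -1; it is nonzero
    because p would otherwise be the center of the sphere. *)
Lemma tangentP p :
  tangent H S p <-> contact H S p /\ exists l, pencil_vertex l p.
Proof.
split=> -[cp Ep]; split=> //.
  pose l := xc ^+ 2 + yc ^+ 2 + h ^+ 2 - r ^+ 2
    - xc * p 0 0 - yc * p 1 0 - h * p 2 0.
  exists l; apply/pencil_vertexP => Y.
  (* the projection of Y onto the kernel of the first form along the last axis *)
  pose Z : 'cV[R]_4 := \col_i [:: Y 0 0; Y 1 0; Y 2 0; Y 3 0 + form H (hom p) Y]`_i.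
  have /Ep : form H (hom p) Z = 0 by rewrite /Z !form_hypE !mxE /=; ring.
  by rewrite /Z !form_sphE form_hypE !mxE /= -/l => ZE; lra.
case: Ep => l vp Y; have := vp; rewrite pencil_vertexP => ->.
suff ln0 : l != 0.
  split=> [->|/eqP]; first by rewrite mulr0.
  by rewrite mulf_eq0 oppr_eq0 (negPf ln0) => /eqP.
apply: contraTneq (r2_gt0) => l0; move: vp cp => [].
rewrite l0 !addr0 !subr0 => /(mulfI a2_neq0) <- /(mulfI a2_neq0) <-.
move=> /(mulfI c2_neq0) <- ? /contactP[_]; rewrite -leNgt; lra.
Qed.

(** Both surfaces are symmetric with respect to a vertical plane through OZ and the
    center, so that their normals at a point of that plane lie in it. *)
Lemma tangent_inW u v p : (u, v) != (0, 0) -> vplane u v (hom (pt3 xc yc h)) ->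
  tangent_in u v H S p -> tangent H S p.
Proof.
move=> uvn0; rewrite /vplane /= !mxE /= => Cuv [cp].
rewrite /vplane /= !mxE /= => puv Ep.
rewrite tangentP; split=> //.
(* The factor l is found as for tangentP, with vectors Y of the plane only. *)
pose l := xc ^+ 2 + yc ^+ 2 + h ^+ 2 - r ^+ 2
  - xc * p 0 0 - yc * p 1 0 - h * p 2 0.
exists l.
have E Y : v * Y 0 0 = u * Y 1 0 -> form S (hom p) Y = - l * form H (hom p) Y.
  move=> Yuv.
  pose Z : 'cV[R]_4 := \col_i [:: Y 0 0; Y 1 0; Y 2 0; Y 3 0 + form H (hom p) Y]`_i.
  have /Ep : vplane u v Z by rewrite /vplane /= !mxE.
  have -> : form H (hom p) Z = 0 by rewrite /Z !form_hypE !mxE /=; ring.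
  by case=> /(_ erefl) + _; rewrite /Z !form_sphE form_hypE !mxE /= -/l => ZE; lra.
pose e x y z w : 'cV[R]_4 := \col_i [:: x; y; z; w]`_i.
have := E (e u v 0 0); have := E (e 0 0 1 0); have := E (e 0 0 0 1).
rewrite !form_hypE !form_sphE /e !mxE /= !(mulr0, mulr1) addr0.
have [s [xE yE]] := collinear_scale uvn0 puv; rewrite xE yE.
have [k [xcE ycE]] := collinear_scale uvn0 Cuv.
move=> /(_ erefl) k1 /(_ erefl) kz /(_ (mulrC _ _)) kxy.
have n_gt0 := sqr_sum_gt0 uvn0.
have sk : a ^+ 2 * k = a ^+ 2 * s + l * s.
  suff : a ^+ 2 * (s - k) = - l * s by lra.
  apply: (mulIf (lt0r_neq0 n_gt0)); move/(congr1 ( *%R (a ^+ 2))): kxy.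
  rewrite xcE ycE.
  have -> : a ^+ 2 * (- l * (s * u / a ^+ 2 * u + s * v / a ^+ 2 * v - 0 - 0)) =
    - l * s * (u ^+ 2 + v ^+ 2) by field; rewrite gt_eqF.
  by move=> <-; ring.
split.
- by rewrite xE xcE [RHS]mulrA sk; ring.
- by rewrite yE ycE [RHS]mulrA sk; ring.
- by rewrite -[h](subKr (p 2 0)) (_ : p 2 0 - h = l * p 2 0 / c ^+ 2);
    [field; rewrite gt_eqF|lra].
- by rewrite /l; lra.
Qed.

(** The form [l H + S] vanishes at p, hence so does S if H does. *)
Lemma vertex_on_sphere l p :
  c ^+ 2 * (p 0 0 ^+ 2 + p 1 0 ^+ 2) = a ^+ 2 * (c ^+ 2 + p 2 0 ^+ 2) ->
  pencil_vertex l p -> contact H S p.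
Proof.
move=> hp [kx ky kz k1]; apply/contactP; split=> //.
apply: (mulfI a2_neq0); apply: (mulfI c2_neq0).
have ex : a ^+ 2 * xc * p 0 0 = (a ^+ 2 + l) * p 0 0 ^+ 2 by rewrite -kx; ring.
have ey : a ^+ 2 * yc * p 1 0 = (a ^+ 2 + l) * p 1 0 ^+ 2 by rewrite -ky; ring.
have ez : c ^+ 2 * h * p 2 0 = (c ^+ 2 - l) * p 2 0 ^+ 2 by rewrite -kz; ring.
have -> : r ^+ 2 = xc ^+ 2 + yc ^+ 2 + h ^+ 2 - l
  - (xc * p 0 0 + yc * p 1 0 + h * p 2 0) by lra.
apply/eqP; rewrite -subr_eq0; apply/eqP.
transitivity (c ^+ 2 * (a ^+ 2 * (p 0 0 ^+ 2 + p 1 0 ^+ 2)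
  - a ^+ 2 * xc * p 0 0 - a ^+ 2 * yc * p 1 0)
  + a ^+ 2 * (c ^+ 2 * p 2 0 ^+ 2 - c ^+ 2 * h * p 2 0) + c ^+ 2 * a ^+ 2 * l).
  by ring.
rewrite ex ey ez.
transitivity (- l * (c ^+ 2 * (p 0 0 ^+ 2 + p 1 0 ^+ 2)
  - a ^+ 2 * (c ^+ 2 + p 2 0 ^+ 2))); first by ring.
by rewrite hp subrr mulr0.
Qed.

(** The equations of [pencil_vertex] express the center and the radius of the
    sphere in terms of p and l; after substitution the cubic factors, with third
    root [c ^+ 2 + (a ^+ 2 + c ^+ 2) * z ^+ 2 / c ^+ 2]. *)
Lemma vertex_double_root l p : contact H S p -> pencil_vertex l p ->
  exists2 m : R, 0 < m & forall t, cubic t = (t - l) * (t - l) * (t - m).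
Proof.
move=> cp vp; have [xcE ycE hE] := pencil_vertex_center vp.
have [_ _ _ k1] := vp; have XE := contact_radius cp.
exists (c ^+ 2 + (a ^+ 2 + c ^+ 2) * p 2 0 ^+ 2 / c ^+ 2).
  apply: ltr_wpDr => //; rewrite divr_ge0 ?(ltW c2_gt0) //.
  by rewrite mulr_ge0 ?sqr_ge0 // addr_ge0 ?ltW.
move=> t; set X := radius (p 2 0) ^+ 2 in XE.
have nE : xc ^+ 2 + yc ^+ 2 = ((a ^+ 2 + l) / a ^+ 2) ^+ 2 * X.
  by rewrite xcE ycE -XE; ring.
have dE : xc * p 0 0 + yc * p 1 0 = (a ^+ 2 + l) / a ^+ 2 * X.
  by rewrite xcE ycE -XE; ring.
have -> : cubic t = (a ^+ 2 + t) * (c ^+ 2 - t)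
    * (xc * p 0 0 + yc * p 1 0 + h * p 2 0 + l - t)
  - (xc ^+ 2 + yc ^+ 2) * a ^+ 2 * (c ^+ 2 - t)
  - h ^+ 2 * c ^+ 2 * (a ^+ 2 + t).
  by rewrite k1 /cubic; ring.
by rewrite dE nE /X sqr_radiusE hE; field; rewrite !gt_eqF.
Qed.

(** The hypotheses place p in a vertical plane through OZ and the center, on the
    side of the center if [0 < k] and on the other side if [k < 0]. *)
Lemma meridian_center k p : contact H S p ->
  xc = k * p 0 0 -> yc = k * p 1 0 ->
  xc ^+ 2 + yc ^+ 2 = k ^+ 2 * radius (p 2 0) ^+ 2 /\
  r ^+ 2 = (1 - k) ^+ 2 * radius (p 2 0) ^+ 2 + (p 2 0 - h) ^+ 2.
Proof.
move=> cp xcE ycE; have [_ <-] := (contactP p).1 cp.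
by rewrite -(contact_radius cp) xcE ycE; split; ring.
Qed.

(** The value [a ^+ 2 * (k - 1)] is the one for which the quadric of the pencil is
    singular at p as far as the horizontal coordinates are concerned; what remains
    is the defect of singularity in the vertical direction. *)
Lemma cubic_meridian k p : contact H S p -> xc = k * p 0 0 -> yc = k * p 1 0 ->
  cubic (a ^+ 2 * (k - 1)) =
  - k * (a ^+ 2 * c ^+ 2)
    * ((1 - a ^+ 2 * (k - 1) / c ^+ 2) * p 2 0 - h) ^+ 2.
Proof.
move=> cp xcE ycE; have [nE rE] := meridian_center cp xcE ycE.
by rewrite /cubic rE nE sqr_radiusE; field; rewrite gt_eqF.
Qed.

(** The last equation of [pencil_vertex] follows from the other three, because p
    lies on every quadric of the pencil. *)
Lemma meridian_vertex k p : contact H S p -> xc = k * p 0 0 -> yc = k * p 1 0 ->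
  (1 - a ^+ 2 * (k - 1) / c ^+ 2) * p 2 0 = h ->
  pencil_vertex (a ^+ 2 * (k - 1)) p.
Proof.
move=> cp xcE ycE hE; have [nE rE] := meridian_center cp xcE ycE.
split.
- by rewrite xcE; ring.
- by rewrite ycE; ring.
- by rewrite -hE; field; rewrite gt_eqF.
transitivity (k * radius (p 2 0) ^+ 2 + h * p 2 0).
  by rewrite xcE ycE -(contact_radius cp); ring.
by rewrite nE rE sqr_radiusE -hE; field; rewrite gt_eqF.
Qed.

(** The first three equations of [pencil_vertex] determine p. The fourth one then
    says that l is a root, and p lies on H because the root is double. *)
Lemma double_root_vertex l m : (forall t, cubic t = (t - l) * (t - l) * (t - m)) ->
  a ^+ 2 + l != 0 -> c ^+ 2 - l != 0 ->
  let p := pt3 (a ^+ 2 * xc / (a ^+ 2 + l)) (a ^+ 2 * yc / (a ^+ 2 + l))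
    (c ^+ 2 * h / (c ^+ 2 - l)) in
  pencil_vertex l p /\ contact H S p.
Proof.
move=> E An0 Bn0 p.
have xE : p 0 0 = a ^+ 2 * xc / (a ^+ 2 + l) by rewrite !mxE.
have yE : p 1 0 = a ^+ 2 * yc / (a ^+ 2 + l) by rewrite !mxE.
have zE : p 2 0 = c ^+ 2 * h / (c ^+ 2 - l) by rewrite !mxE.
have vp : pencil_vertex l p.
  split.
  - by rewrite xE mulrC divfK.
  - by rewrite yE mulrC divfK.
  - by rewrite zE mulrC divfK.
  have := E l; rewrite subrr !mul0r /cubic => El.
  rewrite xE yE zE; apply: (mulfI An0); apply: (mulfI Bn0).
  transitivity (a ^+ 2 * (c ^+ 2 - l) * (xc ^+ 2 + yc ^+ 2)
    + c ^+ 2 * (a ^+ 2 + l) * h ^+ 2); first by field; rewrite An0 Bn0.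
  by apply/eqP; rewrite -subr_eq0; apply/eqP; rewrite -[RHS]oppr0 -El; ring.
split=> //; apply: vertex_on_sphere (vp).
have [xcE ycE hE] := pencil_vertex_center vp; have [_ _ _ k1] := vp.
pose X := p 0 0 ^+ 2 + p 1 0 ^+ 2; pose z2 := p 2 0 ^+ 2.
(* Once the center is expressed through p and l, this is the quotient of the
   cubic by t - l; its value at l is the equation of H at p. *)
pose q t := - ((a ^+ 2 + t) * (c ^+ 2 - t))
  + (a ^+ 2 + l) * (c ^+ 2 - t) * X / a ^+ 2
  - (c ^+ 2 - l) * (a ^+ 2 + t) * z2 / c ^+ 2.
have ql : q l = 0.
  apply: (double_root_cofactor (m := m)) => [|t]; first by rewrite /q; ring.
  rewrite mulrA -E.
  have -> : cubic t = (a ^+ 2 + t) * (c ^+ 2 - t)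
      * (xc * p 0 0 + yc * p 1 0 + h * p 2 0 + l - t)
    - (xc ^+ 2 + yc ^+ 2) * a ^+ 2 * (c ^+ 2 - t)
    - h ^+ 2 * c ^+ 2 * (a ^+ 2 + t) by rewrite k1 /cubic; ring.
  by rewrite xcE ycE hE /q /X /z2; field; rewrite !gt_eqF.
have : (a ^+ 2 + l) * (c ^+ 2 - l) * (X / a ^+ 2 - z2 / c ^+ 2 - 1) = 0.
  by rewrite -ql /q; ring.
move/eqP; rewrite !mulf_eq0 (negPf An0) (negPf Bn0) /= => /eqP hp.
apply/eqP; rewrite -subr_eq0 -/X -/z2; apply/eqP.
transitivity (a ^+ 2 * c ^+ 2 * (X / a ^+ 2 - z2 / c ^+ 2 - 1)).
  by field; rewrite !gt_eqF.
by rewrite hp mulr0.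
Qed.

Lemma cubic0_lt0 : cubic 0 < 0.
Proof.
have -> : cubic 0 = - (a ^+ 2 * c ^+ 2 * r ^+ 2) by rewrite /cubic; ring.
by rewrite oppr_lt0 !mulr_gt0.
Qed.

Lemma cubicN :
  cubic (- a ^+ 2) = - ((xc ^+ 2 + yc ^+ 2) * a ^+ 2 * (c ^+ 2 + a ^+ 2)).
Proof. by rewrite /cubic; ring. Qed.

(** When the cubic is expanded as below, no term is positive on this
    half-line. *)
Lemma cubic_lt0 t : t <= - (a ^+ 2 + r ^+ 2) -> cubic t < 0.
Proof.
move=> tar.
have -> : cubic t = (a ^+ 2 + t) * ((c ^+ 2 - t) * (- t - r ^+ 2))
  + (xc ^+ 2 + yc ^+ 2) * (t * (c ^+ 2 - t))
  - h ^+ 2 * (t * (a ^+ 2 + t)) by rewrite /cubic; ring.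
have [ag0 cg0 rg0] := And3 a2_gt0 c2_gt0 r2_gt0.
have t0 : t < 0 by lra.
have A0 : a ^+ 2 + t < 0 by lra.
have B0 : 0 < c ^+ 2 - t by lra.
have D0 : 0 < - t - r ^+ 2 by lra.
have n0 : 0 <= xc ^+ 2 + yc ^+ 2 by rewrite addr_ge0 ?sqr_ge0.
have h1 : (a ^+ 2 + t) * ((c ^+ 2 - t) * (- t - r ^+ 2)) < 0.
  by rewrite nmulr_rlt0 // mulr_gt0.
have h2 : (xc ^+ 2 + yc ^+ 2) * (t * (c ^+ 2 - t)) <= 0.
  by rewrite mulr_ge0_le0 // ltW // nmulr_rlt0.
have h3 : 0 <= h ^+ 2 * (t * (a ^+ 2 + t)).
  by rewrite mulr_ge0 ?sqr_ge0 // ltW // nmulr_rgt0.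
by lra.
Qed.

(** The third root is read off from the sum of the roots; it is positive because
    the cubic is negative at 0. *)
Lemma third_root l2 l3 : l2 < l3 -> l3 < 0 -> cubic l2 = 0 -> cubic l3 = 0 ->
  exists2 l4 : R, 0 < l4 & forall t, cubic t = (t - l2) * (t - l3) * (t - l4).
Proof.
move=> l23 l30 e2 e3.
pose l4 := c ^+ 2 - a ^+ 2 + (xc ^+ 2 + yc ^+ 2 + h ^+ 2 - r ^+ 2) - l2 - l3.
pose d t := cubic t - (t - l2) * (t - l3) * (t - l4).
have d2 : d l2 = 0 by rewrite /d e2 subrr !mul0r subrr.
have d3 : d l3 = 0 by rewrite /d e3 subrr mulr0 mul0r subrr.
have E t : cubic t = (t - l2) * (t - l3) * (t - l4).
  apply/eqP; rewrite -subr_eq0 -/(d t).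
  have : d t * (l2 - l3) = d l2 * (t - l3) - d l3 * (t - l2).
    by rewrite /d /l4 /cubic; ring.
  rewrite d2 d3 !mul0r subrr => /eqP; rewrite mulf_eq0 => /orP[//|].
  by rewrite subr_eq0 (lt_eqF l23).
exists l4 => //; have := cubic0_lt0; rewrite E !sub0r mulrNN mulrN oppr_lt0.
by rewrite pmulr_rgt0 // nmulr_rgt0 //; lra.
Qed.

Lemma distinct_rootsP : (exists l2 l3 l4, roots_are a c r xc yc h l2 l3 l4 /\
    [/\ l2 < l3, l3 <= - a ^+ 2 & 0 < l4]) <->
  exists2 t : R, t < - a ^+ 2 & 0 < cubic t.
Proof.
split=> [[l2 [l3 [l4 [/roots_areP E [l23 l3a l40]]]]]|[t ta ct]].
  have m1 : l2 < (l2 + l3) / 2 by lra.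
  have m2 : (l2 + l3) / 2 < l3 by lra.
  have ag0 := a2_gt0.
  exists ((l2 + l3) / 2); first by lra.
  set s := _ / 2 in m1 m2 *.
  have s23 : (s - l2) * (s - l3) < 0 by rewrite pmulr_rlt0 ?subr_gt0 ?subr_lt0.
  by rewrite E nmulr_rgt0 // subr_lt0; lra.
have tar : - (a ^+ 2 + r ^+ 2) < t.
  by rewrite ltNge; apply/negP => /cubic_lt0; rewrite ltNge (ltW ct).
have [|l2 /andP[_ l2t]] := @poly_ivt _ cubic_poly _ _ (ltW tar).
  by rewrite !horner_cubic (ltW ct) andbT ltW // cubic_lt0.
rewrite /root horner_cubic => /eqP e2.
have [|l3 /andP[tl3 l3a]] := @poly_ivt _ (- cubic_poly) _ _ (ltW ta).
  rewrite !hornerN !horner_cubic oppr_le0 (ltW ct) cubicN opprK /=.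
  by apply: mulr_ge0; [apply: mulr_ge0|]; rewrite ?addr_ge0 ?sqr_ge0.
rewrite /root hornerN oppr_eq0 horner_cubic => /eqP e3.
have l2t' : l2 < t.
  by rewrite lt_neqAle l2t andbT; apply: contraTneq ct => <-; rewrite e2 ltxx.
have tl3' : t < l3.
  by rewrite lt_neqAle tl3 andbT; apply: contraTneq ct => ->; rewrite e3 ltxx.
have [|l4 l40 E] := third_root (lt_trans l2t' tl3') _ e2 e3.
  by apply: le_lt_trans l3a _; rewrite oppr_lt0.
by exists l2, l3, l4; split; [exact/roots_areP | split=> //; exact: lt_trans tl3'].
Qed.

(** * Tangency along a circumference *)

Lemma center_on_axis : cubic (- a ^+ 2) = 0 -> xc = 0 /\ yc = 0.
Proof.
have K_gt0 : 0 < a ^+ 2 * (c ^+ 2 + a ^+ 2) by rewrite mulr_gt0 // addr_gt0.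
rewrite cubicN -mulrA => /eqP; rewrite oppr_eq0 mulf_eq0 (gt_eqF K_gt0) orbF.
by rewrite paddr_eq0 ?sqr_ge0 // !sqrf_eq0 => /andP[/eqP + /eqP].
Qed.

(** For the direct implication it is enough to look at two opposite points of the
    circle whose difference is not vertical. *)
Lemma TIcP : type_TIc a c r xc yc h <->
  exists l2 l3 l4, roots_are a c r xc yc h l2 l3 l4 /\
    [/\ l2 = l3, l3 = - a ^+ 2 & 0 < l4].
Proof.
split=> [[ctr [n [rho [nn0 rho0 sub]]]]|].
  (* v is orthogonal to n and horizontal *)
  pose b := (n 0 0 == 0) && (n 1 0 == 0).
  pose v := if b then pt3 1 0 0 else pt3 (n 1 0) (- n 0 0) 0.
  have nv : dot n v = 0.
    rewrite dotE /v; case: ifP => [/andP[/eqP-> /eqP->]|_]; rewrite !mxE /=; ring.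
  have v2 : v 2 0 = 0 by rewrite /v; case: ifP; rewrite !mxE.
  have vv : 0 < v 0 0 ^+ 2 + v 1 0 ^+ 2.
    rewrite /v; case: ifP => [_|/negbT]; rewrite !mxE /=.
      by rewrite expr1n expr0n addr0 ltr01.
    rewrite /b negb_and => /orP[?|?].
      by rewrite sqrrN ltr_wpDl ?sqr_ge0 // exprn_even_gt0.
    by rewrite sqrrN ltr_pwDl ?sqr_ge0 // exprn_even_gt0.
  pose k := rho / Num.sqrt (v 0 0 ^+ 2 + v 1 0 ^+ 2).
  have kn0 : k != 0 by rewrite mulf_neq0 ?invr_eq0 ?gt_eqF ?sqrtr_gt0.
  have kE : k ^+ 2 * (v 0 0 ^+ 2 + v 1 0 ^+ 2) = rho ^+ 2.
    by rewrite /k expr_div_n sqr_sqrtr ?(ltW vv) // divfK ?gt_eqF.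
  have circ s : s ^+ 2 = k ^+ 2 -> circumference ctr n rho (ctr + s *: v).
    move=> sk; rewrite /circumference /= addrC addKr; split.
      transitivity (s * dot n v); last by rewrite nv mulr0.
      by rewrite !dotE !mxE; ring.
    by rewrite dotE !mxE v2 -kE -sk; ring.
  have /sub/tangentP[c1 [l1 v1]] : circumference ctr n rho (ctr + k *: v).
    exact: circ.
  have /sub/tangentP[c2 [l2 v2']] : circumference ctr n rho (ctr + (- k) *: v).
    by apply: circ; rewrite sqrrN.
  have [m1 m1_gt0 E1] := vertex_double_root c1 v1.
  have [m2 _ E2] := vertex_double_root c2 v2'.
  have l12 : l1 = l2.
    by apply: (@double_root_uniq R l1 m1 l2 m2) => t; rewrite -E1 E2.
  suff l1E : l1 = - a ^+ 2.
    by exists l1, l1, m1; split; [exact/roots_areP|].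
  apply/eqP; rewrite -addr_eq0 addrC; apply: contraTT vv => ln0.
  move: v1 v2' => [x1 y1 _ _] [x2 y2 _ _].
  rewrite -l12 -x1 in x2; rewrite -l12 -y1 in y2.
  move/(mulfI ln0): x2; move/(mulfI ln0): y2; rewrite !mxE => y2 x2.
  have ->: v 0 0 = 0 by apply: (mulfI kn0); lra.
  have ->: v 1 0 = 0 by apply: (mulfI kn0); lra.
  by rewrite expr0n addr0 ltxx.
case=> l2 [l3 [l4 [/roots_areP E [l23 l3a l40]]]].
rewrite l23 l3a in E.
have [xc0 yc0] : xc = 0 /\ yc = 0.
  by apply: center_on_axis; rewrite E subrr mul0r mul0r.
have ca_gt0 : 0 < c ^+ 2 + a ^+ 2 by rewrite addr_gt0.
pose q t := (c ^+ 2 - t) * (h ^+ 2 - r ^+ 2 - t) - h ^+ 2 * c ^+ 2.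
have : q (- a ^+ 2) = 0.
  apply: (double_root_cofactor (m := l4)) => [|t]; first by rewrite /q; ring.
  rewrite !opprK; transitivity (cubic t); last by rewrite E; ring.
  by rewrite /cubic xc0 yc0 /q; ring.
rewrite /q !opprK => qa.
pose z := c ^+ 2 * h / (c ^+ 2 + a ^+ 2).
have zE : (c ^+ 2 + a ^+ 2) * z = c ^+ 2 * h by rewrite mulrC divfK ?gt_eqF.
exists (pt3 0 0 z), (pt3 0 0 1), (radius z); split.
- apply/eqP => /colP /(_ 2); rewrite !mxE /= => /eqP; rewrite oner_eq0 //.
- exact: radius_gt0.
move=> p [] /=; rewrite !dotE !mxE /= => pz pxy.
have pzE : p 2 0 = z by lra.
have vp : pencil_vertex (- a ^+ 2) p.
  split; rewrite ?addrN ?mul0r ?xc0 ?yc0 ?mulr0 ?opprK ?pzE ?zE //.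
  apply: (mulfI (lt0r_neq0 ca_gt0)).
  transitivity (h * ((c ^+ 2 + a ^+ 2) * z)); first by ring.
  by rewrite zE; lra.
apply/tangentP; split; last by exists (- a ^+ 2).
apply: vertex_on_sphere vp; rewrite pzE -sqr_radius -pxy pzE; ring.
Qed.

(** * Contact points over a given direction *)

Definition meridian u v z : 'cV[R]_3 := pt3 (radius z * u) (radius z * v) z.

(** The power with respect to the sphere of the point of the hyperboloid that has
    height z and lies over the unit vector (u, v). *)
Definition excess u v z : R :=
  (radius z * u - xc) ^+ 2 + (radius z * v - yc) ^+ 2 + (z - h) ^+ 2 - r ^+ 2.

Lemma meridian_contact u v z : u ^+ 2 + v ^+ 2 = 1 ->
  contact H S (meridian u v z) <-> excess u v z = 0.
Proof.
move=> uv1; rewrite contactP !mxE /= /excess.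
have -> : (radius z * u) ^+ 2 + (radius z * v) ^+ 2 = radius z ^+ 2.
  by rewrite !exprMn -mulrDr uv1 mulr1.
by rewrite sqr_radius; split=> [[_ ->]|/eqP]; rewrite ?subrr // subr_eq0 => /eqP.
Qed.

Lemma contact_meridian p : contact H S p ->
  let u := p 0 0 / radius (p 2 0) in let v := p 1 0 / radius (p 2 0) in
  u ^+ 2 + v ^+ 2 = 1 /\ p = meridian u v (p 2 0).
Proof.
move=> cp u v; have r0 := radius_gt0 (p 2 0).
split; last first.
  by apply: cV3P; rewrite !mxE //= mulrC divfK ?gt_eqF.
by rewrite !expr_div_n -mulrDl contact_radius // divff // gt_eqF // exprn_gt0.
Qed.

Lemma continuous_radius : continuous radius.
Proof.
move=> z; apply: cvgM; first exact: cvg_cst.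
apply: (@continuous_comp _ _ _ (fun x : R => c ^+ 2 + x ^+ 2) Num.sqrt).
  apply: cvgD; first exact: cvg_cst.
  exact: exprn_continuous.
exact: sqrt_continuous.
Qed.

Lemma cvg_excess (T : topologicalType) (F : set_system T) (U V Z : T -> R) u v z :
  Filter F -> U @ F --> u -> V @ F --> v -> Z @ F --> z ->
  (fun x => excess (U x) (V x) (Z x)) @ F --> excess u v z.
Proof.
move=> FF Uu Vv Zz.
have Rz : (radius \o Z) @ F --> radius z.
  exact: continuous_cvg (continuous_radius (x:=z)) Zz.
rewrite /excess; apply: cvgB; last exact: cvg_cst.
under eq_fun do rewrite !expr2; rewrite !expr2.
by apply: cvgD; [apply: cvgD|]; apply: cvgM; apply: cvgB => //; do ?exact: cvg_cst;
  apply: cvgM.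
Qed.

(** Here e is a sign, so that the search goes upwards or downwards from z. At the
    heights [h + e * r] the excess is a sum of two squares. *)
Lemma excess_crossing u v z e : e ^+ 2 = 1 -> excess u v z < 0 ->
  exists2 s : R, 0 < s & excess u v (z + e * s) = 0.
Proof.
move=> e1 ez.
pose m := e * (h - z) + r.
have zm : z + e * m = h + e * r by rewrite /m mulrDr mulrA -expr2 e1; ring.
have m_gt0 : 0 < m.
  have hz : (z - h) ^+ 2 < r ^+ 2.
    by apply: le_lt_trans (_ : _ < _) => //; rewrite /excess in ez;
      have := sqr_ge0 (radius z * u - xc); have := sqr_ge0 (radius z * v - yc); lra.
  have : `|e * (h - z)| < r.
    rewrite -(ltr_pXn2r (n:=2)) ?nnegrE ?(ltW r_gt0) //.
    by rewrite real_normK ?num_real // exprMn e1 mul1r -opprB sqrrN.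
  by rewrite ltr_norml /m => /andP[+ _]; lra.
pose f s := excess u v (z + e * s).
have f0 : f 0 < 0 by rewrite /f mulr0 addr0.
have fm : 0 <= f m.
  by rewrite /f zm /excess; have := sqr_ge0 (radius (h + e * r) * u - xc);
   have := sqr_ge0 (radius (h + e * r) * v - yc);
   have : (h + e * r - h) ^+ 2 = r ^+ 2; [rewrite addrC addKr exprMn e1 mul1r|lra].
have [||s] := @IVT _ f 0 m 0 (ltW m_gt0).
- apply: continuous_subspaceT => s; apply: cvg_excess; try exact: cvg_cst.
  by apply: cvgD; [exact: cvg_cst|apply: cvgM; [exact: cvg_cst|]].
- by rewrite ge_min le_max (ltW f0) fm orbT.
rewrite in_itv /= => /andP[s0 _] fs; exists s => //.
by rewrite lt_neqAle s0 andbT; apply: contraTneq f0 => e0; rewrite [X in f X]e0 fs ltxx.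
Qed.

(** * Tangent and non-tangent contact *)

Lemma opp_pair_neq0 u v : (u, v) != (0, 0) -> (- u, - v) != (0, 0).
Proof. by rewrite !xpair_eqE !oppr_eq0. Qed.

(** With [(- u, - v)] for [(u, v)], this describes the other branch. *)
Lemma branch_scale u v p : (u, v) != (0, 0) -> branch H u v p ->
  exists w, [/\ 0 < w, p 0 0 = w * u & p 1 0 = w * v].
Proof.
move=> uvn0 [_]; rewrite /vplane /= !mxE /= => puv p_gt0.
have [w [xE yE]] := collinear_scale uvn0 puv; exists w; split=> //.
rewrite -(pmulr_lgt0 _ (sqr_sum_gt0 uvn0)).
by move: p_gt0; rewrite xE yE; lra.
Qed.

(** The double root l attached to the tangency point cannot be [- a ^+ 2], where
    the rotational symmetry would produce a second tangency point. It cannot be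
    larger either: the tangency would be on the branch near the center, and the
    contact point of the far branch would give the cubic a nonnegative value to
    the left of [- a ^+ 2], where [(t - l) ^+ 2 * (t - m)] is negative. *)
Lemma Td_double_root : type_Td a c r xc yc h ->
  exists l2 l3 l4, roots_are a c r xc yc h l2 l3 l4 /\
    [/\ l2 = l3, l3 < - a ^+ 2 & 0 < l4].
Proof.
case=> -[p0 [_ uniq_p0]] _ [u [v [uvn0 Cuv [p [bp tp]] [q [bq cq]] _]]].
have {tp} tp := tangent_inW uvn0 Cuv tp.
move: (tp) => /tangentP[cp [l vp]].
have [m m0 E] := vertex_double_root cp vp.
exists l, l, m; split; [exact/roots_areP|split=> //].
have [kx ky kz k1] := vp.
rewrite ltNge le_eqVlt; apply/negP => /orP[/eqP lE|l_gt].
  have [xc0 yc0] : xc = 0 /\ yc = 0.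
    by apply: center_on_axis; rewrite lE E subrr !mul0r.
  (* a half turn around OZ gives another tangency point *)
  pose p' := pt3 (- p 0 0) (- p 1 0) (p 2 0).
  have tp' : tangent H S p'.
    apply/tangentP; split.
      by move/contactP: cp => [hp sp]; apply/contactP; rewrite !mxE /=;
        split; [rewrite !sqrrN|rewrite -sp xc0 yc0; ring].
    exists l; split; rewrite !mxE /= ?mulrN -?lE ?addrN ?mul0r ?oppr0 ?xc0 ?yc0 ?mulr0 //.
      by rewrite lE.
    by move: k1; rewrite xc0 yc0 -lE; lra.
  have pp' : p = p' by rewrite -(uniq_p0 _ tp) -(uniq_p0 _ tp').
  have := contact_off_axis cp.
  have /(congr1 (fun q : 'cV[R]_3 => q 0 0)) := pp'; rewrite !mxE /= => x0.
  have /(congr1 (fun q : 'cV[R]_3 => q 1 0)) := pp'; rewrite !mxE /= => y0.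
  have -> : p 0 0 = 0 by lra.
  have -> : p 1 0 = 0 by lra.
  by rewrite expr0n addr0 ltxx.
have [w [w_gt0 xE yE]] := branch_scale uvn0 bp.
have [s [s_gt0 x'E y'E]] := branch_scale (opp_pair_neq0 uvn0) bq.
pose al := (a ^+ 2 + l) / a ^+ 2.
have al_gt0 : 0 < al by rewrite divr_gt0 //; lra.
have xcE : xc = al * (w * u) by rewrite -xE /al mulrAC kx mulrAC divff ?mul1r.
have ycE : yc = al * (w * v) by rewrite -yE /al mulrAC ky mulrAC divff ?mul1r.
pose k := - (al * w / s).
have k_lt0 : k < 0 by rewrite oppr_lt0 divr_gt0 // mulr_gt0.
have : cubic (a ^+ 2 * (k - 1)) = - k * (a ^+ 2 * c ^+ 2)
  * ((1 - a ^+ 2 * (k - 1) / c ^+ 2) * q 2 0 - h) ^+ 2.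
  by apply: cubic_meridian => //; rewrite /k ?x'E ?y'E ?xcE ?ycE; field; rewrite gt_eqF.
rewrite E => Ek.
have : 0 <= - k * (a ^+ 2 * c ^+ 2)
  * ((1 - a ^+ 2 * (k - 1) / c ^+ 2) * q 2 0 - h) ^+ 2.
  by rewrite mulr_ge0 ?sqr_ge0 // mulr_ge0 ?oppr_ge0 ?(ltW k_lt0) // mulr_ge0 ?ltW.
rewrite -Ek leNgt => /negP; apply.
have ta : a ^+ 2 * (k - 1) < - a ^+ 2.
  by have := nmulr_llt0 (a ^+ 2) k_lt0; rewrite a2_gt0 => ?; lra.
have ag0 := a2_gt0.
by rewrite pmulr_rlt0 ?subr_lt0; [lra|rewrite nmulr_lgt0 subr_lt0; lra].
Qed.

(** The tangency point lies on the branch opposite to the center. At its height,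
    the point of the other branch is inside the sphere, so the sphere meets that
    branch as well. *)
Lemma double_root_Td l m : (forall t, cubic t = (t - l) * (t - l) * (t - m)) ->
  l < - a ^+ 2 -> 0 < m -> type_Td a c r xc yc h.
Proof.
move=> E la m0.
have A_lt0 : a ^+ 2 + l < 0 by lra.
have [An0 Bn0] : a ^+ 2 + l != 0 /\ c ^+ 2 - l != 0.
  by have [ag0 cg0] := (a2_gt0, c2_gt0); split; [rewrite lt_eqF|rewrite gt_eqF //; lra].
have := double_root_vertex E An0 Bn0; set p := pt3 _ _ _ => -[vp cp].
have tp : tangent H S p by apply/tangentP; split=> //; exists l.
have uniq_p p' : tangent H S p' -> p = p'.
  case/tangentP => cp' [l' vp'].
  have [m' _ E'] := vertex_double_root cp' vp'.
  have ll' : l = l' by apply: (@double_root_uniq R l m l' m') => t; rewrite -E E'.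
  case: vp vp' => x1 y1 z1 _ [x2 y2 z2 _]; rewrite -ll' in x2 y2 z2.
  by apply: cV3P; [apply: (mulfI An0)|apply: (mulfI An0)|apply: (mulfI Bn0)];
    rewrite ?x2 ?y2 ?z2.
have [kx ky kz k1] := vp.
have n_gt0 : 0 < xc ^+ 2 + yc ^+ 2.
  rewrite lt_neqAle addr_ge0 ?sqr_ge0 // andbT eq_sym; apply/negP => /eqP n0.
  have := cubicN; rewrite n0 !mul0r oppr0 E => /eqP; rewrite !mulf_eq0 !subr_eq0.
  have -> : (- a ^+ 2 == l) = false by rewrite gt_eqF.
  by have ag0 := a2_gt0; rewrite lt_eqF //; lra.
have Cn0 : (xc, yc) != (0, 0).
  by apply: contraTneq n_gt0 => -[-> ->]; rewrite expr0n addr0 ltxx.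
pose k := a ^+ 2 / (a ^+ 2 + l).
have k_lt0 : k < 0 by rewrite /k pmulr_rlt0 ?invr_lt0.
have xE : p 0 0 = k * xc by rewrite !mxE /= /k mulrAC.
have yE : p 1 0 = k * yc by rewrite !mxE /= /k mulrAC.
have pC : p 0 0 * xc + p 1 0 * yc < 0.
  rewrite xE yE (_ : _ + _ = k * (xc ^+ 2 + yc ^+ 2)); last by ring.
  by rewrite nmulr_rlt0.
have [uv1 pE] := contact_meridian cp.
set u := _ / _ in uv1 pE; set v := p 1 0 / _ in uv1 pE.
have rp := radius_gt0 (p 2 0).
have uE : radius (p 2 0) * u = p 0 0 by rewrite mulrC divfK ?gt_eqF.
have vE : radius (p 2 0) * v = p 1 0 by rewrite mulrC divfK ?gt_eqF.
have uD : u = p 0 0 / radius (p 2 0) by [].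
have vD : v = p 1 0 / radius (p 2 0) by [].
clearbody u v.
have uvC : u * xc + v * yc < 0.
  rewrite -(pmulr_rlt0 _ rp) (_ : radius _ * _ = p 0 0 * xc + p 1 0 * yc) //.
  by rewrite mulrDr !mulrA uE vE.
have uv1' : (- u) ^+ 2 + (- v) ^+ 2 = 1 by rewrite !sqrrN.
have ez : excess (- u) (- v) (p 2 0) < 0.
  have /contactP[_ sp] := cp.
  by rewrite /excess !mulrN uE vE -sp; lra.
have [s _ es] := excess_crossing (expr1n _ 2) ez.
set z := p 2 0 + 1 * s in es; pose q := meridian (- u) (- v) z.
have cq : contact H S q by apply/meridian_contact.
have rz := radius_gt0 z.
have qC : 0 < xc * q 0 0 + yc * q 1 0.
  rewrite !mxE /= (_ : _ + _ = radius z * - (u * xc + v * yc)); last by ring.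
  by rewrite mulr_gt0 // oppr_gt0.
have ntq : ~ tangent H S q.
  move/uniq_p => pq; move: pC; rewrite pq; lra.
have hC : vplane (- xc) (- yc) (hom (pt3 xc yc h)).
  by rewrite /vplane /= !mxE /=; ring.
have nC0 := opp_pair_neq0 Cn0.
split.
- by exists p; split.
- by exists q.
exists (- xc), (- yc); split=> //.
- exists p; split; last split=> //.
  + split; [exact: cp.1| |lra].
    by rewrite /vplane /= !mxE /=; ring.
  + by rewrite /vplane /= !mxE /=; ring.
  + by move=> Y _; exact: tp.2.
- exists q; rewrite !opprK; split=> //; split=> //; first exact: cq.1.
  rewrite /vplane /= /q /meridian !mxE /=.
  have uE' : u = k * xc / radius (p 2 0) by rewrite -xE uD.
  have vE' : v = k * yc / radius (p 2 0) by rewrite -yE vD.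
  by rewrite uE' vE'; ring.
move=> q' [_ _]; rewrite !opprK => q'C _ tq'.
have /uniq_p pq' := tangent_inW nC0 hC tq'.
by move: pC; rewrite pq'; lra.
Qed.

(** * The two sheets of a quadric of the pencil *)

(** A branch of a hyperbola is at most as steep as its asymptotes. *)
Lemma radius_lipschitz z1 z2 :
  c ^+ 2 * (radius z2 - radius z1) ^+ 2 <= a ^+ 2 * (z2 - z1) ^+ 2.
Proof.
have [r1 r2] := (radius_gt0 z1, radius_gt0 z2).
have [e1 e2] := (sqr_radius z1, sqr_radius z2).
have : a ^+ 2 * (c ^+ 2 + z1 * z2) <= c ^+ 2 * (radius z1 * radius z2).
  rewrite leNgt; apply/negP => lt12.
  have p0 : 0 <= c ^+ 2 * (radius z1 * radius z2).
    by apply/ltW/mulr_gt0 => //; apply: mulr_gt0.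
  have : (c ^+ 2 * (radius z1 * radius z2)) ^+ 2 < (a ^+ 2 * (c ^+ 2 + z1 * z2)) ^+ 2.
    by rewrite ltr_pXn2r ?nnegrE // (le_trans p0 (ltW lt12)).
  have -> : (c ^+ 2 * (radius z1 * radius z2)) ^+ 2 =
    (c ^+ 2 * radius z1 ^+ 2) * (c ^+ 2 * radius z2 ^+ 2) by ring.
  rewrite e1 e2 => lt22.
  have := sqr_ge0 (a ^+ 2 * c * (z1 - z2)); lra.
lra.
Qed.

Section Sheets.
Variable t : R.
Hypotheses (t_lt : t < - a ^+ 2) (t_gt0 : 0 < cubic t).

(** A, A and B are the coefficients of the squares in [t H + S], [zb] is the
    height of its center of symmetry and [- dl] the constant left after completing
    the squares. *)
Let A := (a ^+ 2 + t) / a ^+ 2.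
Let B := (c ^+ 2 - t) / c ^+ 2.
Let zb := h / B.
Let dl := - (xc ^+ 2 + yc ^+ 2 + h ^+ 2 - r ^+ 2 - t
  - (xc ^+ 2 + yc ^+ 2) / A - h ^+ 2 / B).

Let A_lt0 : A < 0. Proof.
by rewrite /A pmulr_llt0 ?invr_gt0 //; have := t_lt; lra.
Qed.

Let B_gt0 : 0 < B.
Proof.
by have [ag0 cg0 ta] := And3 a2_gt0 c2_gt0 t_lt; rewrite /B divr_gt0 //; lra.
Qed.

Let A_neq0 : A != 0. Proof. exact: ltr0_neq0. Qed.
Let B_neq0 : B != 0. Proof. exact: lt0r_neq0. Qed.

(** The product of A, B and [- dl] is a positive multiple of the cubic. *)
Let dl_gt0 : 0 < dl. Proof.
have AB : A * B < 0 by rewrite nmulr_rlt0.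
rewrite -(nmulr_llt0 _ AB) -(pmulr_llt0 _ (mulr_gt0 a2_gt0 c2_gt0)).
rewrite (_ : _ * _ = - cubic t) ?oppr_lt0 //.
rewrite /dl /cubic.
transitivity (- (A * B * (a ^+ 2 * c ^+ 2) * (xc ^+ 2 + yc ^+ 2 + h ^+ 2 - r ^+ 2 - t)
  - (xc ^+ 2 + yc ^+ 2) * (a ^+ 2 * c ^+ 2 * B) - h ^+ 2 * (a ^+ 2 * c ^+ 2 * A))).
  by field; rewrite ?A_neq0 ?B_neq0.
by rewrite /A /B; field; rewrite !gt_eqF.
Qed.

(** On the hyperboloid the forms S and [t H + S] coincide, hence the excess is
    the equation of the two-sheeted hyperboloid [t H + S] centered at height
    [zb]. *)
Lemma excess_sheets u v z : u ^+ 2 + v ^+ 2 = 1 ->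
  excess u v z = B * (z - zb) ^+ 2
    + A * ((radius z * u - xc / A) ^+ 2 + (radius z * v - yc / A) ^+ 2) - dl.
Proof.
move=> uv1.
have rE : radius z ^+ 2 * (u ^+ 2 + v ^+ 2) / a ^+ 2 - z ^+ 2 / c ^+ 2 - 1 = 0.
  rewrite uv1 mulr1.
  have -> : radius z ^+ 2 = a ^+ 2 * (c ^+ 2 + z ^+ 2) / c ^+ 2.
    by rewrite -sqr_radius mulrAC divff ?mul1r.
  by field; rewrite !gt_eqF.
rewrite -[LHS](addr0) -(mulr0 t) -rE /excess.
have -> : B * (z - zb) ^+ 2 = B * z ^+ 2 - 2 * h * z + h ^+ 2 / B.
  by rewrite /zb; field; rewrite ?B_neq0.
transitivity (A * (radius z ^+ 2 * (u ^+ 2 + v ^+ 2))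
  - 2 * radius z * (xc * u + yc * v) + B * z ^+ 2 - 2 * h * z
  + (xc ^+ 2 + yc ^+ 2 + h ^+ 2 - r ^+ 2 - t)).
  by rewrite /A /B; field; rewrite !gt_eqF.
by rewrite /dl; field; rewrite ?A_neq0 ?B_neq0.
Qed.

Lemma excess_waist u v : u ^+ 2 + v ^+ 2 = 1 -> excess u v zb < 0.
Proof.
move=> uv1; rewrite excess_sheets // subrr expr0n mulr0 add0r subr_lt0.
by apply: le_lt_trans dl_gt0; rewrite mulr_le0_ge0 ?(ltW A_lt0) // addr_ge0 ?sqr_ge0.
Qed.

(** Moving away from the middle plane by d changes the radius by m with
    [c ^+ 2 * m ^+ 2 <= a ^+ 2 * d ^+ 2], and [- A * a ^+ 2 < B * c ^+ 2]: the
    vertical square wins over the horizontal ones ([contr]), and the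
    Cauchy-Schwarz inequality handles the cross term ([cross]). *)
Lemma excess_mono u v e s1 s2 : u ^+ 2 + v ^+ 2 = 1 -> e ^+ 2 = 1 ->
  0 <= s1 -> s1 < s2 ->
  0 <= excess u v (zb + e * s1) -> 0 < excess u v (zb + e * s2).
Proof.
move=> uv1 e1 s1_ge0 s12; rewrite !excess_sheets // ![zb + _]addrC !addrK.
set r1 := radius (e * s1 + zb); set r2 := radius (e * s2 + zb).
have lip : c ^+ 2 * (r2 - r1) ^+ 2 <= a ^+ 2 * (s2 - s1) ^+ 2.
  have := radius_lipschitz (e * s1 + zb) (e * s2 + zb).
  rewrite (_ : (_ + _ - _) ^+ 2 = e ^+ 2 * (s2 - s1) ^+ 2); last by ring.
  by rewrite e1 mul1r.
rewrite !exprMn e1 !mul1r => ex1.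
set d := s2 - s1 in lip; have d_gt0 : 0 < d by rewrite subr_gt0.
set m := r2 - r1 in lip.
have -> : s2 = s1 + d by rewrite /d addrC subrK.
have -> : r2 = r1 + m by rewrite /m addrC subrK.
set X := r1 * u - xc / A in ex1; set Y := r1 * v - yc / A in ex1.
have contr : - A * m ^+ 2 < B * d ^+ 2.
  rewrite -(ltr_pM2l c2_gt0).
  have : - A * (c ^+ 2 * m ^+ 2) <= - A * (a ^+ 2 * d ^+ 2).
    by rewrite ler_pM2l ?oppr_gt0.
  have -> : - A * (a ^+ 2 * d ^+ 2) = - (a ^+ 2 + t) * d ^+ 2.
    by rewrite /A; field; rewrite gt_eqF.
  have -> : c ^+ 2 * (B * d ^+ 2) = (c ^+ 2 - t) * d ^+ 2.
    by rewrite /B; field; rewrite gt_eqF.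
  have : 0 < (a ^+ 2 + c ^+ 2) * d ^+ 2 by rewrite mulr_gt0 ?addr_gt0 ?exprn_gt0.
  by lra.
have cross : - A * m * (X * u + Y * v) <= B * s1 * d.
  have Bsd : 0 <= B * s1 * d by rewrite mulr_ge0 ?(ltW d_gt0) // mulr_ge0 // ltW.
  rewrite leNgt; apply/negP => lt12.
  have : (B * s1 * d) ^+ 2 < (- A * m * (X * u + Y * v)) ^+ 2.
    by rewrite ltr_pXn2r ?nnegrE // (le_trans Bsd (ltW lt12)).
  have cs : (X * u + Y * v) ^+ 2 <= X ^+ 2 + Y ^+ 2.
    rewrite -[leRHS]mulr1 -uv1; have := sqr_ge0 (X * v - Y * u); lra.
  apply/negP; rewrite -leNgt.
  apply: (@le_trans _ _ ((- A * m ^+ 2) * (- A * (X ^+ 2 + Y ^+ 2)))).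
    have -> : (- A * m ^+ 2) * (- A * (X ^+ 2 + Y ^+ 2)) =
      (- A) ^+ 2 * m ^+ 2 * (X ^+ 2 + Y ^+ 2) by ring.
    rewrite (_ : (- A * m * _) ^+ 2 = (- A) ^+ 2 * m ^+ 2 * (X * u + Y * v) ^+ 2).
      by rewrite ler_wpM2l // mulr_ge0 ?sqr_ge0.
    by ring.
  have -> : (B * s1 * d) ^+ 2 = (B * d ^+ 2) * (B * s1 ^+ 2) by ring.
  have nA : 0 <= - A by rewrite oppr_ge0 ltW.
  have dl0 := dl_gt0.
  apply: ler_pM; rewrite ?(ltW contr) //.
  - by rewrite mulr_ge0 ?sqr_ge0.
  - by rewrite mulr_ge0 // addr_ge0 ?sqr_ge0.
  - by lra.
have -> : (r1 + m) * u - xc / A = X + m * u by rewrite /X; ring.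
have -> : (r1 + m) * v - yc / A = Y + m * v by rewrite /Y; ring.
have -> : (X + m * u) ^+ 2 + (Y + m * v) ^+ 2 =
  X ^+ 2 + Y ^+ 2 + 2 * m * (X * u + Y * v) + m ^+ 2.
  transitivity (X ^+ 2 + Y ^+ 2 + 2 * m * (X * u + Y * v)
    + m ^+ 2 * (u ^+ 2 + v ^+ 2)); first by ring.
  by rewrite uv1 mulr1.
by lra.
Qed.


(** The distance from the middle plane to the contact point that lies over the
    direction (u, v), above that plane if e is 1 and below it if e is -1. *)
Definition height e u v : R :=
  get [set s | 0 < s /\ excess u v (zb + e * s) = 0].

Lemma heightP e u v : e ^+ 2 = 1 -> u ^+ 2 + v ^+ 2 = 1 ->
  0 < height e u v /\ excess u v (zb + e * height e u v) = 0.
Proof.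
move=> e1 uv1; rewrite /height; case: xgetP => [s -> //|none].
have [s s0 es] := excess_crossing e1 (excess_waist uv1).
by have := none s; case.
Qed.

Lemma excess_below e u v s : e ^+ 2 = 1 -> u ^+ 2 + v ^+ 2 = 1 ->
  0 <= s -> s < height e u v -> excess u v (zb + e * s) < 0.
Proof.
move=> e1 uv1 s0 sh; rewrite ltNge; apply/negP => /(excess_mono uv1 e1 s0 sh).
by have [_ ->] := heightP e1 uv1; rewrite ltxx.
Qed.

Lemma excess_above e u v s : e ^+ 2 = 1 -> u ^+ 2 + v ^+ 2 = 1 ->
  height e u v < s -> 0 < excess u v (zb + e * s).
Proof.
move=> e1 uv1 hs; have [h0 he] := heightP e1 uv1.
by apply: excess_mono hs _ => //; rewrite ?he // ltW.
Qed.

Lemma height_uniq e u v s : e ^+ 2 = 1 -> u ^+ 2 + v ^+ 2 = 1 ->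
  0 <= s -> excess u v (zb + e * s) = 0 -> s = height e u v.
Proof.
move=> e1 uv1 s0 es; have [sh|hs|//] := ltgtP s (height e u v).
  by have := excess_below e1 uv1 s0 sh; rewrite es ltxx.
by have := excess_above e1 uv1 hs; rewrite es ltxx.
Qed.

(** The sign of the excess at two heights around the zero persists for nearby
    angles, and the zero stays between these heights. *)
Lemma continuous_height e : e ^+ 2 = 1 ->
  continuous (fun x => height e (cos x) (sin x)).
Proof.
move=> e1 x; apply/cvgrPdist_lt => eps eps0.
have uv1 y : cos y ^+ 2 + sin y ^+ 2 = 1 :> R := cos2Dsin2 y.
set s := height e (cos x) (sin x).
have [s_gt0 _] := heightP e1 (uv1 x); rewrite -/s in s_gt0.
pose d := Num.min eps s / 2.
have d0 : 0 < d by rewrite divr_gt0 // lt_min eps0.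
have [d1 d2] : d < eps /\ d < s.
  have m0 : 0 < Num.min eps s by rewrite lt_min eps0.
  have m1 : Num.min eps s <= eps by rewrite ge_min lexx.
  have m2 : Num.min eps s <= s by rewrite ge_min lexx orbT.
  by rewrite /d; split; lra.
have cE z : excess (cos y) (sin y) z @[y --> x] --> excess (cos x) (sin x) z.
  by apply: cvg_excess; [exact: continuous_cos|exact: continuous_sin|exact: cvg_cst].
have sd0 : 0 <= s - d by lra.
have lo : excess (cos x) (sin x) (zb + e * (s - d)) < 0.
  by apply: excess_below => //; rewrite -/s; lra.
have hi : 0 < excess (cos x) (sin x) (zb + e * (s + d)).
  by apply: excess_above => //; rewrite -/s; lra.
near=> y.
have lo_y : excess (cos y) (sin y) (zb + e * (s - d)) < 0.
  near: y; exact: cvgr_lt (cE _) _ lo.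
have hi_y : 0 < excess (cos y) (sin y) (zb + e * (s + d)).
  near: y; exact: cvgr_gt (cE _) _ hi.
have [hy0 hyE] := heightP e1 (uv1 y).
have h1 : s - d < height e (cos y) (sin y).
  rewrite ltNge; apply/negP => le1.
  have : 0 <= excess (cos y) (sin y) (zb + e * (s - d)).
    move: le1; rewrite le_eqVlt => /orP[/eqP <-|lt1]; first by rewrite hyE.
    exact/ltW/excess_above.
  by rewrite leNgt lo_y.
have h2 : height e (cos y) (sin y) < s + d.
  rewrite ltNge; apply/negP => le1.
  have : excess (cos y) (sin y) (zb + e * (s + d)) <= 0.
    move: le1; rewrite le_eqVlt => /orP[/eqP ->|lt1]; first by rewrite hyE.
    by apply/ltW/excess_below => //; lra.
  by rewrite leNgt hi_y.
rewrite ltr_norml; apply/andP; split; lra.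
Unshelve. all: by end_near. Qed.

Definition sheet_curve e x : 'cV[R]_3 :=
  meridian (cos x) (sin x) (zb + e * height e (cos x) (sin x)).

Lemma continuous_sheet_curve e : e ^+ 2 = 1 -> continuous (sheet_curve e).
Proof.
move=> e1.
have cz : continuous (fun x => zb + e * height e (cos x) (sin x)).
  move=> x; apply: cvgD; first exact: cvg_cst.
  by apply: cvgM; [exact: cvg_cst|exact: continuous_height].
have cr : continuous (fun x => radius (zb + e * height e (cos x) (sin x))).
  by move=> x; apply: continuous_cvg (cz x); exact: continuous_radius.
apply: continuous_pt3 => // x; apply: cvgM; rewrite ?[_ @ _]/=.
- exact: cr.
- exact: continuous_cos.
- exact: cr.
- exact: continuous_sin.
Qed.

Definition sheet e : set 'cV[R]_3 :=
  contact H S `&` [set p | 0 < e * (p 2 0 - zb)].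

Lemma sheet_curveP e : e ^+ 2 = 1 -> sheet e = range (sheet_curve e).
Proof.
move=> e1; apply/seteqP; split=> [p [cp /= ep]|_ [x _ <-]].
  have [uv1 pE] := contact_meridian cp.
  have [x [uE vE]] := unit_circle_angle uv1.
  exists x => //; rewrite pE /sheet_curve -uE -vE; congr meridian.
  rewrite -(@height_uniq e _ _ (e * (p 2 0 - zb)) e1 uv1 (ltW ep)).
    by rewrite mulrA -expr2 e1 mul1r addrC subrK.
  rewrite mulrA -expr2 e1 mul1r addrC subrK.
  by apply/meridian_contact => //; rewrite -pE.
have [h0 hE] := heightP e1 (cos2Dsin2 x); split.
  by apply/meridian_contact => //; exact: cos2Dsin2.
by rewrite /= !mxE /= addrC addKr mulrA -expr2 e1 mul1r.
Qed.

Lemma contact_sheets p : contact H S p -> sheet 1 p \/ sheet (-1) p.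
Proof.
move=> cp; have [uv1 pE] := contact_meridian cp.
have [lt|gt|eqz] := ltgtP (p 2 0) zb.
- by right; split=> //=; lra.
- by left; split=> //=; lra.
have := excess_waist uv1; rewrite -eqz.
by move: cp; rewrite {1}pE => /(meridian_contact _ uv1) ->; rewrite ltxx.
Qed.

(** * Topology of the contact set *)

Lemma sheet_connected e : e ^+ 2 = 1 -> connected (sheet e).
Proof.
move=> e1; rewrite sheet_curveP //; apply: connected_continuous_connected.
  by apply/connected_intervalP.
exact/continuous_subspaceT/continuous_sheet_curve.
Qed.

Lemma sheet_curve_in e : e ^+ 2 = 1 -> sheet e (sheet_curve e 0).
Proof. by move=> e1; rewrite sheet_curveP //; exists 0. Qed.

Lemma sheet_disjoint p : sheet 1 p -> ~ sheet (-1) p.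
Proof. by move=> [_ /= p1] [_ /=]; lra. Qed.

(** A connected part of the contact set meeting both sheets would contain a point
    of height [zb] by the intermediate value property. *)
Lemma component_sheet e p : e ^+ 2 = 1 -> sheet e p ->
  connected_component (contact H S) p = sheet e.
Proof.
move=> e1 sp; apply/seteqP; split; last first.
  by apply: connected_component_max sp _ (sheet_connected e1) => q [].
move=> q [D [Dp DC Dconn] Dq].
have /connected_intervalP zD : connected ((fun p : 'cV[R]_3 => p 2 0) @` D).
  apply: connected_continuous_connected => //.
  exact/continuous_subspaceT/coord_continuous.
split; first exact: DC.
rewrite /= ltNge; apply/negP => qe; case: sp => _ /= pe.
have [b /= Db bz] : ((fun p : 'cV[R]_3 => p 2 0) @` D) zb.
  have [e_1|e_1] : e = 1 \/ e = -1.
    by have /eqP := e1; rewrite sqrf_eq1 => /orP[/eqP|/eqP]; auto.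
  - by apply: (zD (q 2 0) (p 2 0)); [by exists q|by exists p|];
      rewrite e_1 in qe pe; apply/andP; split; lra.
  - by apply: (zD (p 2 0) (q 2 0)); [by exists p|by exists q|];
      rewrite e_1 in qe pe; apply/andP; split; lra.
by have [[_ /=]|[_ /=]] := contact_sheets (DC _ Db); rewrite bz subrr mulr0 ltxx.
Qed.

Lemma card_components : (components (contact H S) #= `I_2)%card.
Proof.
have e1 : 1 ^+ 2 = 1 :> R by rewrite expr1n.
have eN1 : (-1) ^+ 2 = 1 :> R by rewrite sqrrN expr1n.
have cE : components (contact H S) = [set sheet 1; sheet (-1)].
  apply/seteqP; split=> [_ [p cp <-]|_ /= [->|->]].
  - have [sp|sp] := contact_sheets cp; [left|right]; exact: component_sheet sp.
  - have sp := sheet_curve_in e1; exists (sheet_curve 1 0); first by case: sp.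
    exact: component_sheet sp.
  - have sp := sheet_curve_in eN1; exists (sheet_curve (-1) 0); first by case: sp.
    exact: component_sheet sp.
rewrite cE; apply/eq_cardSP; exists (sheet 1); first by left.
rewrite (_ : _ `\ _ = [set sheet (-1)]) ?card_set1 //.
apply/seteqP; split=> [D [[/= ->|/= ->] nD]|D ->]; [by case: nD|by []|split; first by right].
move=> /= E; have := sheet_curve_in eN1; rewrite E => sp.
by have := sheet_curve_in eN1; exact: sheet_disjoint.
Qed.

(** Around the point of angle [x0] the chart is the angle itself: for a point whose
    horizontal part has a positive component n along [x0] and a component m across
    it, the angle is [x0 + atan (m / n)]. *)
Lemma contact_is_curve : is_curve (contact H S).
Proof.
move=> p cp.
have [e [e1 sp]] : exists e : R, e ^+ 2 = 1 /\ sheet e p.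
  by have [sp|sp] := contact_sheets cp; [exists 1|exists (-1)]; rewrite ?sqrrN expr1n.
have [x0 _ px0] : range (sheet_curve e) p by rewrite -sheet_curveP.
pose n (q : 'cV[R]_3) := q 0 0 * cos x0 + q 1 0 * sin x0.
pose m (q : 'cV[R]_3) := q 1 0 * cos x0 - q 0 0 * sin x0.
pose k q := x0 + atan (m q / n q).
have cc (i : 'I_3) : continuous (fun q : 'cV[R]_3 => q i 0).
  exact: coord_continuous.
have cw (i : 'I_3) (w : R) : continuous (fun q : 'cV[R]_3 => q i 0 * w).
  by move=> q; exact: cvgM (cc i q) (cvg_cst w).
have cn : continuous n by move=> q; exact: cvgD (cw 0 _ q) (cw 1 _ q).
have cm : continuous m by move=> q; exact: cvgB (cw 1 _ q) (cw 0 _ q).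
have cz : continuous (fun q : 'cV[R]_3 => e * (q 2 0 - zb)).
  by move=> q; exact: cvgM (cvg_cst e) (cvgB (cc 2 q) (cvg_cst zb)).
have oU (f : 'cV[R]_3 -> R) : continuous f -> open [set q | 0 < f q].
  move=> cf; apply: (open_comp (f := f) (D := [set x : R | 0 < x])).
    by move=> q _; exact: cf.
  exact: open_gt.
pose U : set 'cV[R]_3 :=
  [set q : 'cV[R]_3 | 0 < e * (q 2 0 - zb)] `&` [set q | 0 < n q].
have CU : contact H S `&` U = sheet e `&` [set q | 0 < n q] by rewrite /U setIA.
have nE x : n (sheet_curve e x) =
    radius (zb + e * height e (cos x) (sin x)) * cos (x - x0).
  by rewrite /n /sheet_curve !mxE /= cosB; ring.
have mE x : m (sheet_curve e x) =
    radius (zb + e * height e (cos x) (sin x)) * sin (x - x0).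
  by rewrite /m /sheet_curve !mxE /= sinB; ring.
have kE x : 0 < n (sheet_curve e x) -> k (sheet_curve e x) =
    x0 + atan (sin (x - x0) / cos (x - x0)) /\ 0 < cos (x - x0).
  have r0 := radius_gt0 (zb + e * height e (cos x) (sin x)).
  rewrite /k nE mE pmulr_rgt0 // => c0; split=> //.
  by rewrite invfM mulrACA divff ?mul1r ?gt_eqF.
have itvP x : x \in `]x0 - pi / 2, x0 + pi / 2[ ->
    0 < cos (x - x0) /\ - (pi / 2) < x - x0 < pi / 2.
  rewrite in_itv /= => /andP[x1 x2].
  have xi : - (pi / 2) < x - x0 < pi / 2 by apply/andP; split; lra.
  by split=> //; exact: cos_gt0_pihalf.
have curveU x : x \in `]x0 - pi / 2, x0 + pi / 2[ -> 0 < n (sheet_curve e x).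
  by move=> /itvP[c0 _]; rewrite nE mulr_gt0 // radius_gt0.
exists U, (x0 - pi / 2), (x0 + pi / 2), (sheet_curve e), k; split.
- split; first by apply: openI; [exact: oU cz|exact: oU cn].
  split; first by case: sp.
  rewrite /= -px0 nE subrr cos0 mulr1; exact: radius_gt0.
- exact/continuous_subspaceT/continuous_sheet_curve.
- apply: continuous_in_subspaceT => q /set_mem[_ [_ /= nq]].
  have cq : (m x / n x) @[x --> q] --> m q / n q.
    exact: cvgM (cm q) (cvgV (lt0r_neq0 nq) (cn q)).
  have caq : atan (m x / n x) @[x --> q] --> atan (m q / n q).
    by apply: continuous_cvg cq; exact: continuous_atan.
  exact: cvgD (cvg_cst x0) caq.
- rewrite CU; apply/seteqP; split=> [_ [x xi <-]|q [sq nq]].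
    split; first by rewrite sheet_curveP //; exists x.
    exact: curveU.
  have [y _ yq] : range (sheet_curve e) q by rewrite -sheet_curveP.
  rewrite -yq in nq *; have [kq c0] := kE _ nq.
  exists (k (sheet_curve e y)).
    rewrite /= in_itv /= kq.
    have := atan_gtNpi2 (sin (y - x0) / cos (y - x0)).
    have := atan_ltpi2 (sin (y - x0) / cos (y - x0)).
    by move=> ? ?; apply/andP; split; lra.
  have [cE sE] := atan_tan_angle c0.
  have yE : x0 + (y - x0) = y by rewrite addrC subrK.
  rewrite kq; move: cE sE; set phi := atan _ => cE sE.
  have cy : cos (x0 + phi) = cos y.
    by rewrite -[in RHS]yE (cosD x0 phi) (cosD x0 (y - x0)) cE sE.
  have sy : sin (x0 + phi) = sin y.
    by rewrite -[in RHS]yE (sinD x0 phi) (sinD x0 (y - x0)) cE sE.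
  by rewrite /sheet_curve cy sy.
move=> x xi; have [c0 xx0] := itvP _ xi.
have [-> _] := kE _ (curveU _ xi).
have -> : atan (sin (x - x0) / cos (x - x0)) = x - x0 by apply: tanK; rewrite in_itv.
by rewrite addrC subrK.
Qed.

End Sheets.

(** * Non-tangent contact with two components *)

Lemma axis_plane_direction : exists u v : R, u ^+ 2 + v ^+ 2 = 1 /\ v * xc = u * yc.
Proof.
pose n := xc ^+ 2 + yc ^+ 2.
have [n0|nn0] := eqVneq n 0.
  exists 1, 0; rewrite expr1n expr0n addr0 mul0r mul1r; split=> //.
  move/eqP: n0; rewrite paddr_eq0 ?sqr_ge0 // !sqrf_eq0 => /andP[_ /eqP //].
have n_ge0 : 0 <= n by rewrite addr_ge0 ?sqr_ge0.
exists (xc / Num.sqrt n), (yc / Num.sqrt n); split; last by ring.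
by rewrite !expr_div_n sqr_sqrtr // -mulrDl divff.
Qed.

(** One of the two contact points is not on the side of the center, and it is not
    a tangency point, so [cubic_meridian] gives a positive value unless k is 0.
    In that case the center is on OZ, the cubic vanishes at [- a ^+ 2] and is
    decreasing there. *)
Lemma Ca_cubic_gt0 : type_Ca a c r xc yc h ->
  exists2 t : R, t < - a ^+ 2 & 0 < cubic t.
Proof.
case=> _ nt _ _ [u [v [uvn0 Cuv [p [bp cp]] [q [bq cq]]]]].
move: Cuv; rewrite /vplane /= !mxE /= => Cuv.
have [j [xcE ycE]] := collinear_scale uvn0 Cuv.
have [w [w_gt0 xE yE]] := branch_scale uvn0 bp.
have [s [s_gt0 x'E y'E]] := branch_scale (opp_pair_neq0 uvn0) bq.
have [k [p' [k_le0 cp' xcE' ycE']]] : exists k p',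
    [/\ k <= 0, contact H S p', xc = k * p' 0 0 & yc = k * p' 1 0].
  have [j0|/ltW j0] := leP j 0.
    exists (j / w), p; rewrite pmulr_lle0 ?invr_gt0 //.
    by rewrite xE yE xcE ycE; split=> //; field; rewrite gt_eqF.
  exists (- (j / s)), q; rewrite oppr_le0 divr_ge0 ?(ltW s_gt0) //.
  by rewrite x'E y'E xcE ycE; split=> //; field; rewrite gt_eqF.
have zn0 : 0 < ((1 - a ^+ 2 * (k - 1) / c ^+ 2) * p' 2 0 - h) ^+ 2.
  rewrite exprn_even_gt0 //= subr_eq0; apply/eqP => hE; apply: (nt p').
  apply/tangentP; split=> //; exists (a ^+ 2 * (k - 1)).
  exact: meridian_vertex.
move: k_le0; rewrite le_eqVlt => /orP[/eqP k0|k_lt0]; last first.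
  exists (a ^+ 2 * (k - 1)).
    have : a ^+ 2 * k < 0 by rewrite pmulr_rlt0.
    by lra.
  rewrite (cubic_meridian cp' xcE' ycE') mulr_gt0 // mulr_gt0 ?oppr_gt0 //.
  by rewrite mulr_gt0.
rewrite k0 !mul0r in xcE' ycE'.
(* As the center is on OZ, the cubic is a ^+ 2 + t times this quadratic f. *)
pose f t := (c ^+ 2 - t) * (h ^+ 2 - r ^+ 2 - t) - h ^+ 2 * c ^+ 2.
have cubicE t : cubic t = (a ^+ 2 + t) * f t.
  by rewrite /cubic xcE' ycE' /f; ring.
pose f0 := f (- a ^+ 2).
have f0_lt0 : f0 < 0.
  rewrite -oppr_gt0 (_ : - f0 =
    c ^+ 2 * ((1 - a ^+ 2 * (k - 1) / c ^+ 2) * p' 2 0 - h) ^+ 2).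
    by rewrite mulr_gt0.
  move/contactP: cp' => [hp' sp'].
  rewrite /f0 /f -sp' xcE' ycE' k0.
  rewrite (_ : _ + _ + (_ - h) ^+ 2 = a ^+ 2 * (c ^+ 2 + p' 2 0 ^+ 2) / c ^+ 2
    + (p' 2 0 - h) ^+ 2).
    by field; rewrite gt_eqF.
  by rewrite -hp'; field; rewrite gt_eqF.
pose f1 := 2 * a ^+ 2 + c ^+ 2 + h ^+ 2 - r ^+ 2.
have fE e : f (- a ^+ 2 - e) = f0 + f1 * e + e ^+ 2 by rewrite /f0 /f /f1; ring.
(* The step e is chosen so that e < 1 and e * (`|f1| + 1) < - f0. *)
pose M := `|f1| + 1 - f0.
have M_gt0 : 0 < M by have := normr_ge0 f1; rewrite /M; lra.
pose e := - f0 / M.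
have e_gt0 : 0 < e by rewrite divr_gt0 // oppr_gt0.
have eM : e * M = - f0 by rewrite divfK // gt_eqF.
have e_lt1 : e < 1 by rewrite ltr_pdivrMr // mul1r /M; have := normr_ge0 f1; lra.
exists (- a ^+ 2 - e); first by lra.
rewrite cubicE (_ : a ^+ 2 + (- a ^+ 2 - e) = - e); last by ring.
rewrite nmulr_rgt0 ?oppr_lt0 // fE.
have h1 : f1 * e <= `|f1| * e by rewrite ler_pM2r // ler_norm.
have h2 : e ^+ 2 < e by rewrite expr2 gtr_pMl.
have h3 : e * f0 < 0 by rewrite pmulr_rlt0.
by rewrite /M in eM; lra.
Qed.

(** There is no tangency, because a cubic with a double root and a positive simple
    root is nowhere positive on the negative half-line. *)
Lemma cubic_gt0_Ca t : t < - a ^+ 2 -> 0 < cubic t -> type_Ca a c r xc yc h.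
Proof.
move=> t_lt t_gt0.
have e1 : 1 ^+ 2 = 1 :> R by rewrite expr1n.
have branch_contact u v : u ^+ 2 + v ^+ 2 = 1 ->
    exists p, branch H u v p /\ contact H S p.
  move=> uv1.
  have [s _ es] := excess_crossing e1 (excess_waist t_lt t_gt0 uv1).
  set z := _ + _ in es.
  have cp : contact H S (meridian u v z) by apply/meridian_contact.
  exists (meridian u v z); split=> //; split; first exact: cp.1.
    by rewrite /vplane /= !mxE /=; ring.
  rewrite !mxE /= (_ : _ + _ = radius z * (u ^+ 2 + v ^+ 2)); last by ring.
  by rewrite uv1 mulr1 radius_gt0.
have [u [v [uv1 Cuv]]] := axis_plane_direction.
split.
- by have [p [_ cp]] := branch_contact _ _ uv1; exists p.
- move=> p /tangentP[cp [l vp]].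
  have [m m0 E] := vertex_double_root cp vp.
  move: t_gt0; rewrite E -expr2 ltNge => /negP; apply.
  by rewrite mulr_ge0_le0 ?sqr_ge0 // subr_le0; have := a2_gt0; lra.
- exact: contact_is_curve t_lt t_gt0.
- exact: card_components t_lt t_gt0.
exists u, v; split.
- rewrite xpair_eqE; apply/negP => /andP[/eqP u0 /eqP v0]; move: uv1.
  by rewrite u0 v0 expr0n addr0 => /eqP; rewrite eq_sym oner_eq0.
- by rewrite /vplane /= !mxE.
- exact: branch_contact.
- by apply: branch_contact; rewrite !sqrrN.
Qed.

End Position.

Theorem theorem10 (R : realType) (a c r xc yc zc : R)
    (a_gt0 : 0 < a) (c_gt0 : 0 < c) (r_gt0 : 0 < r) (le_ar : a <= r) :
  [/\ type_TIc a c r xc yc zc <->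
        (exists l2 l3 l4 : R, roots_are a c r xc yc zc l2 l3 l4 /\
           [/\ l2 = l3, l3 = - a ^+ 2 & 0 < l4]),
      type_Td a c r xc yc zc <->
        (exists l2 l3 l4 : R, roots_are a c r xc yc zc l2 l3 l4 /\
           [/\ l2 = l3, l3 < - a ^+ 2 & 0 < l4])
    & type_Ca a c r xc yc zc <->
        (exists l2 l3 l4 : R, roots_are a c r xc yc zc l2 l3 l4 /\
           [/\ l2 < l3, l3 <= - a ^+ 2 & 0 < l4])].
Proof.
split; first exact: TIcP.
  split; first exact: Td_double_root.
  case=> l2 [l3 [l4 [/(roots_areP _ _ _ _ a_gt0 c_gt0) E [l23 l3a l40]]]].
  by rewrite l23 in E; exact: (double_root_Td a_gt0 c_gt0 r_gt0 E l3a l40).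
rewrite distinct_rootsP //; split; first exact: Ca_cubic_gt0.
by case=> t ta ct; exact: (cubic_gt0_Ca a_gt0 c_gt0 r_gt0 ta ct).
Qed.
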